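(* Let $F$ be a field of characteristic not two with separable closure $F^{\mathrm{sep}}$ and absolute Galois group $\Gamma$, let $\mathbb{G}$ be an affine group superscheme over $F$, and let $V$ be a super quasi-rational irreducible representation of $\mathbb{G}\otimes_F F^{\mathrm{sep}}$. Then $\epsilon_{V_F}=-$ if and only if $V$ is quasi-rational and $V\cong\Pi V$.
   Context: Representations are right supercomodules over the Hopf superalgebra of $\mathbb{G}$, homomorphisms preserve parity, $\Pi$ is parity change, ${}^\sigma V$ is the base change of $V$ along $\sigma\in\Gamma$. An irreducible representation $V$ of $\mathbb{G}\otimes_F F^{\mathrm{sep}}$ is quasi-rational (resp. super quasi-rational) if $\mathrm{End}_{\mathbb{G}\otimes_F F^{\mathrm{sep}}}(V)=F^{\mathrm{sep}}\mathrm{id}_V$ and for every $\sigma\in\Gamma$ one has ${}^\sigma V\cong V$ (resp. ${}^\sigma V\cong V$ or $\Pi V$). $V_F$ denotes the unique irreducible representation of $\mathbb{G}$ such that $V$ is a subrepresentation of $V_F\otimes_F F^{\mathrm{sep}}$. $\underline{\mathrm{End}}_{\mathbb{G}}(V_F)$ is the superalgebra under composition with even part $\mathrm{End}_{\mathbb{G}}(V_F)$ and odd part $\mathrm{Hom}_{\mathbb{G}}(V_F,\Pi V_F)$; when $V$ is super quasi-rational it is a central division superalgebra $D$ over $F$ (central: the even elements commuting with all of $D$ are the scalars $F$). The sign $\epsilon_{V_F}\in\{+,-\}$ is $+$ if $D$ is central simple over $F$ as an ordinary (ungraded) algebra, and $-$ otherwise; equivalently, $\epsilon_{V_F}=-$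 iff $D_{\bar0}$ is a central simple $F$-algebra and $D_{\bar1}\neq0$. *)

(* Defs.v *)
From HB Require Import structures.
From mathcomp Require Import all_boot all_algebra all_field.
From mathcomp Require Import generic_quotient boolp.
Set Implicit Arguments.
Unset Strict Implicit.
Unset Printing Implicit Defensive.
Import GRing.Theory.
Local Open Scope ring_scope.
Local Open Scope quotient_scope.

Definition mk_linear (K : fieldType) (U Z : lmodType K) (f : U -> Z)
    (f_lin : linear f) : {linear U -> Z} :=
  HB.pack f (GRing.isLinear.Build K U Z *:%R f f_lin).

(** Restriction of scalars along [phi : K -> K'].  A [phi]-semilinear map
    [U -> Z] is a linear map [U -> restr phi Z]. *)
Definition restr (K K' : fieldType) (phi : {rmorphism K -> K'})
  (Z : lmodType K') : Type := Z.

Section Restriction.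
Variables (K K' : fieldType) (phi : {rmorphism K -> K'}) (Z : lmodType K').

HB.instance Definition _ := GRing.Zmodule.copy (restr phi Z) Z.

Definition restr_scale (k : K) (z : restr phi Z) : restr phi Z :=
  phi k *: (z : Z).

Fact restr_scaleA a b z :
  restr_scale a (restr_scale b z) = restr_scale (a * b) z.
Proof. by rewrite /restr_scale scalerA rmorphM. Qed.
Fact restr_scale1 : left_id 1 restr_scale.
Proof. by move=> z; rewrite /restr_scale rmorph1 scale1r. Qed.
Fact restr_scaleDr : right_distributive restr_scale +%R.
Proof. by move=> a x y; exact: (scalerDr (phi a) (x : Z) y). Qed.
Fact restr_scaleDl z : {morph restr_scale^~ z : a b / a + b}.
Proof. by move=> a b; rewrite /restr_scale rmorphD; exact: scalerDl. Qed.

HB.instance Definition _ := GRing.Zmodule_isLmodule.Build K (restr phi Z)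
  restr_scaleA restr_scale1 restr_scaleDr restr_scaleDl.

End Restriction.

(** The universal K-module receiving a map from [X] in the class [C]:
    the finite formal sums [\sum_i k_i x_i], two of them being identified when
    every map of the class [C] to a K-module sends them to the same element. *)
Section UniversalModule.
Variables (K : fieldType) (X : choiceType).
Variable C : forall Z : lmodType K, (X -> Z) -> Prop.

Definition fsum (Z : lmodType K) (f : X -> Z) (s : seq (K * X)) : Z :=
  \sum_(p <- s) p.1 *: f p.2.

Definition univ_rel (s t : seq (K * X)) : bool :=
  `[< forall (Z : lmodType K) (f : X -> Z), C f -> fsum f s = fsum f t >].

Fact univ_rel_refl : reflexive univ_rel.
Proof. by move=> s; apply/asboolP. Qed.
Fact univ_rel_sym : symmetric univ_rel.
Proof. by move=> s t; apply/asboolP/asboolP => h Z f Cf; rewrite h. Qed.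
Fact univ_rel_trans : transitive univ_rel.
Proof.
by move=> s t u /asboolP ht /asboolP hu; apply/asboolP => Z f Cf; rewrite ht ?hu.
Qed.

Canonical univ_equiv := EquivRel univ_rel univ_rel_refl univ_rel_sym univ_rel_trans.

Definition univ : Type := {eq_quot univ_rel}.
HB.instance Definition _ := Choice.on univ.

Definition univ_pi (s : seq (K * X)) : univ := \pi_({eq_quot univ_rel}) s.
Definition univ_repr (x : univ) : seq (K * X) :=
  repr (x : {eq_quot univ_rel}).

(** [lift f] is the linear map induced by [f] when [C f] holds; it has no
    meaning otherwise. *)
Definition lift (Z : lmodType K) (f : X -> Z) (x : univ) : Z :=
  fsum f (univ_repr x).

Lemma lift_pi (Z : lmodType K) (f : X -> Z) s : C f -> lift f (univ_pi s) = fsum f s.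
Proof.
have : univ_rel (univ_repr (univ_pi s)) s.
  have /eqmodP := reprK (\pi_({eq_quot univ_rel}) s); exact.
by move=> /asboolP h Cf; exact: h.
Qed.

Lemma univ_eq (x y : univ) :
  (forall (Z : lmodType K) (f : X -> Z), C f -> lift f x = lift f y) -> x = y.
Proof.
move=> h; rewrite -[x]reprK -[y]reprK; apply/eqmodP/asboolP => Z f Cf.
exact: h.
Qed.

Definition univ_add (x y : univ) := univ_pi (univ_repr x ++ univ_repr y).
Definition univ_scale (k : K) (x : univ) :=
  univ_pi [seq (k * p.1, p.2) | p <- univ_repr x].
Definition univ_opp (x : univ) := univ_scale (-1) x.
Definition univ_zero := univ_pi [::].

Lemma lift_add (Z : lmodType K) (f : X -> Z) x y :
  C f -> lift f (univ_add x y) = lift f x + lift f y.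
Proof. by move=> Cf; rewrite lift_pi // /fsum big_cat. Qed.
Lemma lift_scale (Z : lmodType K) (f : X -> Z) k x :
  C f -> lift f (univ_scale k x) = k *: lift f x.
Proof.
move=> Cf; rewrite lift_pi // /fsum big_map scaler_sumr.
by apply: eq_bigr => p _; rewrite scalerA.
Qed.
Lemma lift_zero (Z : lmodType K) (f : X -> Z) : C f -> lift f univ_zero = 0.
Proof. by move=> Cf; rewrite lift_pi // /fsum big_nil. Qed.

Fact univ_addA : associative univ_add.
Proof. by move=> x y z; apply: univ_eq => Z f Cf; rewrite !lift_add // addrA. Qed.
Fact univ_addC : commutative univ_add.
Proof. by move=> x y; apply: univ_eq => Z f Cf; rewrite !lift_add // addrC. Qed.
Fact univ_add0 : left_id univ_zero univ_add.
Proof.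
by move=> x; apply: univ_eq => Z f Cf; rewrite lift_add // lift_zero // add0r.
Qed.
Fact univ_addN : left_inverse univ_zero univ_opp univ_add.
Proof.
move=> x; apply: univ_eq => Z f Cf.
by rewrite lift_add // lift_zero // lift_scale // scaleN1r addNr.
Qed.

HB.instance Definition _ := GRing.isZmodule.Build univ
  univ_addA univ_addC univ_add0 univ_addN.

Fact univ_scaleA a b x : univ_scale a (univ_scale b x) = univ_scale (a * b) x.
Proof. by apply: univ_eq => Z f Cf; rewrite !lift_scale // scalerA. Qed.
Fact univ_scale1 : left_id 1 univ_scale.
Proof. by move=> x; apply: univ_eq => Z f Cf; rewrite lift_scale // scale1r. Qed.
Fact univ_scaleDr : right_distributive univ_scale +%R.
Proof.
move=> a x y; apply: univ_eq => Z f Cf.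
by rewrite lift_scale // !lift_add // !lift_scale // scalerDr.
Qed.
Fact univ_scaleDl x : {morph univ_scale^~ x : a b / a + b}.
Proof.
move=> a b; apply: univ_eq => Z f Cf.
by rewrite lift_add // !lift_scale // scalerDl.
Qed.

HB.instance Definition _ := GRing.Zmodule_isLmodule.Build K univ
  univ_scaleA univ_scale1 univ_scaleDr univ_scaleDl.

Definition univ_in (x : X) : univ := univ_pi [:: (1, x)].

Lemma lift_in (Z : lmodType K) (f : X -> Z) x : C f -> lift f (univ_in x) = f x.
Proof. by move=> Cf; rewrite lift_pi // /fsum big_seq1 scale1r. Qed.

Lemma lift_linear (Z : lmodType K) (f : X -> Z) : C f -> linear (lift f).
Proof.
by move=> Cf a x y; rewrite -lift_scale // -lift_add.
Qed.

Lemma univ_sum (x : univ) :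
  x = \sum_(p <- univ_repr x) p.1 *: univ_in p.2.
Proof.
apply: univ_eq => Z f Cf.
pose g := mk_linear (lift_linear Cf).
have gin y : g (univ_in y) = f y by exact: lift_in.
rewrite -[RHS]/(g _) linear_sum {1}/lift /fsum.
by apply: eq_bigr => p _; rewrite -gin -linearZ.
Qed.

Lemma univ_ext (Z : lmodType K) (f g : univ -> Z) :
  linear f -> linear g ->
  (forall x, f (univ_in x) = g (univ_in x)) -> forall x, f x = g x.
Proof.
move=> f_lin g_lin fg x.
pose f' := mk_linear f_lin; pose g' := mk_linear g_lin.
rewrite -[LHS]/(f' x) -[RHS]/(g' x) (univ_sum x) !linear_sum.
by apply: eq_bigr => p _; rewrite !linearZ; congr (_ *: _); apply: fg.
Qed.

End UniversalModule.

Definition semilinear (K K' : fieldType) (phi : {rmorphism K -> K'})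
    (U : lmodType K) (Z : lmodType K') (f : U -> Z) : Prop :=
  forall a x y, f (a *: x + y) = phi a *: f x + f y.

Definition bilin (K : fieldType) (U W Z : lmodType K) (f : U -> W -> Z) : Prop :=
  (forall w, linear (f^~ w)) /\ (forall u, linear (f u)).

(** The tensor product over K *)
Section Tensor.
Variables (K : fieldType) (U W : lmodType K).

Definition tens : lmodType K :=
  univ (fun Z (f : U * W -> Z) => bilin (fun u w => f (u, w))).

Definition pure (u : U) (w : W) : tens := univ_in _ (u, w).

(** [tlift f] is the linear map induced by [f] when [f] is bilinear; it has no
    meaning otherwise. *)
Definition tlift (Z : lmodType K) (f : U -> W -> Z) (x : tens) : Z :=
  lift (fun p => f p.1 p.2) x.

Lemma tlift_pure (Z : lmodType K) (f : U -> W -> Z) u w :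
  bilin f -> tlift f (pure u w) = f u w.
Proof. by move=> f_bil; rewrite /tlift lift_in. Qed.

Lemma tlift_linear (Z : lmodType K) (f : U -> W -> Z) :
  bilin f -> linear (tlift f).
Proof. by move=> f_bil; apply: lift_linear. Qed.

Lemma tens_ext (Z : lmodType K) (f g : tens -> Z) :
  linear f -> linear g ->
  (forall u w, f (pure u w) = g (pure u w)) -> forall x, f x = g x.
Proof. by move=> fl gl fg; apply: univ_ext => // -[u w]; apply: fg. Qed.

Lemma pure_bilin : bilin pure.
Proof.
split=> [w|u] a x y; apply: univ_eq => Z f Cf; rewrite lift_linear // !lift_in //.
  by case: Cf => Cl _; exact: Cl.
by case: Cf => _ Cr; exact: Cr.
Qed.

End Tensor.

Definition tmap (K : fieldType) (U U' W W' : lmodType K)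
    (f : U -> U') (g : W -> W') : tens U W -> tens U' W' :=
  tlift (fun u w => pure (f u) (g w)).

Definition tassoc (K : fieldType) (U V W : lmodType K) :
    tens (tens U V) W -> tens U (tens V W) :=
  tlift (fun x w => tlift (fun u v => pure u (pure v w)) x).

(** The tensor product of two semilinear maps *)
Definition tmaps (K K' : fieldType) (phi : {rmorphism K -> K'})
    (U W : lmodType K) (U' W' : lmodType K') (f : U -> U') (g : W -> W') :
    tens U W -> tens U' W' :=
  @tlift K U W (restr phi (tens U' W')) (fun u w => pure (f u) (g w)).

Section TensorTheory.
Variables (K K' : fieldType) (phi : {rmorphism K -> K'}).

Lemma linear_comp (U W Z : lmodType K) (f : U -> W) (g : W -> Z) :
  linear f -> linear g -> linear (fun u => g (f u)).
Proof. by move=> fl gl a x y; rewrite fl gl. Qed.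

Lemma linear_id (U : lmodType K) : linear (fun u : U => u).
Proof. by []. Qed.

Lemma linear_add (U W : lmodType K) (f g : U -> W) :
  linear f -> linear g -> linear (fun u => f u + g u).
Proof. by move=> fl gl a x y; rewrite fl gl scalerDr addrACA. Qed.

Lemma semilinear_comp (U : lmodType K) (W Z : lmodType K')
    (f : U -> W) (g : W -> Z) :
  semilinear phi f -> linear g -> semilinear phi (fun u => g (f u)).
Proof. by move=> fl gl a x y; rewrite fl gl. Qed.

Lemma comp_semilinear (U W : lmodType K) (Z : lmodType K')
    (f : U -> W) (g : W -> Z) :
  linear f -> semilinear phi g -> semilinear phi (fun u => g (f u)).
Proof. by move=> fl gl a x y; rewrite fl gl. Qed.

Lemma tens_semi_ext (U W : lmodType K) (Z : lmodType K')
    (f g : tens U W -> Z) :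
  semilinear phi f -> semilinear phi g ->
  (forall u w, f (pure u w) = g (pure u w)) -> forall x, f x = g x.
Proof. exact: (@tens_ext K U W (restr phi Z)). Qed.

Lemma tmap_bilin (U U' W W' : lmodType K) (f : U -> U') (g : W -> W') :
  linear f -> linear g -> bilin (fun u w => pure (f u) (g w)).
Proof.
move=> fl gl; have [pl pr] := pure_bilin U' W'.
by split=> [w|u] a x y; rewrite ?fl ?gl ?(pl _ a) ?(pr _ a).
Qed.

Lemma tmap_linear (U U' W W' : lmodType K) (f : U -> U') (g : W -> W') :
  linear f -> linear g -> linear (tmap f g).
Proof. by move=> fl gl; apply/tlift_linear/tmap_bilin. Qed.

Lemma tmap_pure (U U' W W' : lmodType K) (f : U -> U') (g : W -> W') u w :
  linear f -> linear g -> tmap f g (pure u w) = pure (f u) (g w).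
Proof. by move=> fl gl; apply/tlift_pure/tmap_bilin. Qed.

Lemma tmaps_bilin (U W : lmodType K) (U' W' : lmodType K')
    (f : U -> U') (g : W -> W') :
  semilinear phi f -> semilinear phi g ->
  @bilin K U W (restr phi (tens U' W')) (fun u w => pure (f u) (g w)).
Proof.
move=> fl gl; have [pl pr] := pure_bilin U' W'.
by split=> [w|u] a x y; rewrite ?fl ?gl ?(pl _ (phi a)) ?(pr _ (phi a)).
Qed.

Lemma tmaps_semilinear (U W : lmodType K) (U' W' : lmodType K')
    (f : U -> U') (g : W -> W') :
  semilinear phi f -> semilinear phi g -> semilinear phi (tmaps phi f g).
Proof. by move=> fl gl; exact: (tlift_linear (tmaps_bilin fl gl)). Qed.

Lemma tmaps_pure (U W : lmodType K) (U' W' : lmodType K')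
    (f : U -> U') (g : W -> W') u w :
  semilinear phi f -> semilinear phi g ->
  tmaps phi f g (pure u w) = pure (f u) (g w).
Proof. by move=> fl gl; exact: (tlift_pure _ _ (tmaps_bilin fl gl)). Qed.

Lemma tassoc_bilin1 (U V W : lmodType K) (w : W) :
  bilin (fun (u : U) (v : V) => pure u (pure v w)).
Proof.
have [pl pr] := pure_bilin U (tens V W); have [ql qr] := pure_bilin V W.
by split=> [v|u] a x y; rewrite ?(ql _ a) ?(pl _ a) ?(pr _ a).
Qed.

Lemma tassoc_bilin (U V W : lmodType K) :
  bilin (fun (x : tens U V) (w : W) =>
    tlift (fun u v => pure u (pure v w)) x).
Proof.
split=> [w|x]; first exact/tlift_linear/tassoc_bilin1.
move=> a w w'; move: x; apply: tens_ext => [||u v].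
- exact/tlift_linear/tassoc_bilin1.
- apply: linear_add; last exact/tlift_linear/tassoc_bilin1.
  apply: linear_comp; first exact/tlift_linear/tassoc_bilin1.
  by move=> b x y; rewrite scalerDr !scalerA mulrC.
rewrite !tlift_pure; [|exact: tassoc_bilin1..].
have [_ pr] := pure_bilin U (tens V W); have [_ qr] := pure_bilin V W.
by rewrite qr pr.
Qed.

Lemma tassoc_linear (U V W : lmodType K) : linear (@tassoc K U V W).
Proof. exact/tlift_linear/tassoc_bilin. Qed.

Lemma tassoc_pure (U V W : lmodType K) (u : U) (v : V) (w : W) :
  tassoc (pure (pure u v) w) = pure u (pure v w).
Proof.
by rewrite /tassoc tlift_pure ?tlift_pure //;
  [exact: tassoc_bilin1|exact: tassoc_bilin].
Qed.

End TensorTheory.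

(** A superspace is a vector space with a Z/2-grading, given by its projections
    onto the homogeneous components: [scomp false] onto the even part,
    [scomp true] onto the odd part. *)
Record superspace (K : fieldType) := Superspace {
  ss_sort :> lmodType K;
  scomp : bool -> {linear ss_sort -> ss_sort};
  scomp_scomp : forall i j v,
    scomp i (scomp j v) = if i == j then scomp j v else 0;
  scomp_sum : forall v, scomp false v + scomp true v = v
}.
Arguments scomp {K s} i : rename.

(** The homogeneous component of parity [i] in a tensor product *)
Definition tcomp (K : fieldType) (U W : superspace K) (i : bool)
    (x : tens U W) : tens U W :=
  tmap (scomp false) (scomp i) x + tmap (scomp true) (scomp (~~ i)) x.

Record supercoalg (K : fieldType) := Supercoalg {
  sc_space :> superspace K;
  comul : {linear sc_space -> tens sc_space sc_space};
  counit : {scalar sc_space};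
  comul_even : forall i a, comul (scomp i a) = tcomp i (comul a);
  counit_even : forall a, counit (scomp true a) = 0;
  comulA : forall a,
    tassoc (tmap comul idfun (comul a)) = tmap idfun comul (comul a);
  counitl : forall a, tlift (fun x y => counit x *: y) (comul a) = a;
  counitr : forall a, tlift (fun x y => counit y *: x) (comul a) = a
}.

Arguments comul {K s} : rename.
Arguments counit {K s} : rename.

(** Right supercomodules, of arbitrary dimension *)
Record supercomod (K : fieldType) (B : supercoalg K) := Supercomod {
  sm_space :> superspace K;
  coact : {linear sm_space -> tens sm_space B};
  coact_even : forall i v, coact (scomp i v) = tcomp i (coact v);
  coactA : forall v,
    tassoc (tmap coact idfun (coact v)) = tmap idfun (@comul K B) (coact v);
  coact1 : forall v, tlift (fun x (b : B) => counit b *: x) (coact v) = v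
}.
Arguments coact {K B s} : rename.

Record superalg (K : fieldType) := Superalg {
  sa_sort :> algType K;
  sa_comp : bool -> {linear sa_sort -> sa_sort};
  sa_comp_comp : forall i j a,
    sa_comp i (sa_comp j a) = if i == j then sa_comp j a else 0;
  sa_comp_sum : forall a, sa_comp false a + sa_comp true a = a;
  sa_comp_mul : forall i j a b,
    sa_comp (i (+) j) (sa_comp i a * sa_comp j b) = sa_comp i a * sa_comp j b
}.
Arguments sa_comp {K s} i : rename.

Definition superalg_space (K : fieldType) (A : superalg K) : superspace K :=
  @Superspace K A (@sa_comp K A) (@sa_comp_comp K A) (@sa_comp_sum K A).

(** The product of the superalgebra [A (x) A], with the sign rule
    (a (x) b) (c (x) d) = (-1)^(|b||c|) (ac (x) bd) for b and c homogeneous *)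
Definition tmul (K : fieldType) (A : superalg K) (x y : tens A A) : tens A A :=
  tlift (fun a b => tlift (fun c d =>
    \sum_(i : bool) \sum_(j : bool)
      (-1) ^+ (i && j) *: pure (a * sa_comp j c) (sa_comp i b * d)) y) x.

(** A supercommutative Hopf superalgebra over [K], that is, the coordinate
    superalgebra of an affine group superscheme over [K] *)
Record hopf_superalg (K : fieldType) := HopfSuperalg {
  hs_alg :> superalg K;
  hs_supercomm : forall i j (a b : hs_alg),
    sa_comp i a * sa_comp j b = (-1) ^+ (i && j) *: (sa_comp j b * sa_comp i a);
  hs_comul : {linear hs_alg -> tens hs_alg hs_alg};
  hs_counit : {scalar hs_alg};
  hs_antipode : {linear hs_alg -> hs_alg};
  hs_comul_even : forall i a,
    hs_comul (sa_comp i a) =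
    @tcomp K (superalg_space hs_alg) (superalg_space hs_alg) i (hs_comul a);
  hs_counit_even : forall a, hs_counit (sa_comp true a) = 0;
  hs_antipode_even : forall i a,
    hs_antipode (sa_comp i a) = sa_comp i (hs_antipode a);
  hs_comulA : forall a,
    tassoc (tmap hs_comul idfun (hs_comul a)) =
    tmap idfun hs_comul (hs_comul a);
  hs_counitl : forall a, tlift (fun x y => hs_counit x *: y) (hs_comul a) = a;
  hs_counitr : forall a, tlift (fun x y => hs_counit y *: x) (hs_comul a) = a;
  hs_comul1 : hs_comul 1 = pure 1 1;
  hs_comulM : forall a b, hs_comul (a * b) = tmul (hs_comul a) (hs_comul b);
  hs_counit1 : hs_counit 1 = 1;
  hs_counitM : forall a b, hs_counit (a * b) = hs_counit a * hs_counit b;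
  hs_antipodel : forall a,
    tlift (fun x y => hs_antipode x * y) (hs_comul a) = (hs_counit a)%:A;
  hs_antipoder : forall a,
    tlift (fun x y => x * hs_antipode y) (hs_comul a) = (hs_counit a)%:A
}.

(** A representation of the group superscheme is a right supercomodule over its
    coordinate superalgebra.  This notion, and its base change, only involve the
    underlying supercoalgebra. *)
Definition hopf_coalg (K : fieldType) (G : hopf_superalg K) : supercoalg K :=
  @Supercoalg K (superalg_space G) (@hs_comul K G) (@hs_counit K G)
    (@hs_comul_even K G) (@hs_counit_even K G) (@hs_comulA K G)
    (@hs_counitl K G) (@hs_counitr K G).
Coercion hopf_coalg : hopf_superalg >-> supercoalg.

(** Homomorphisms of representations: even, and compatible with coactions *)
Section Hom.
Variables (K : fieldType) (B : supercoalg K).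

Record shom (V W : supercomod B) := Shom {
  shom_fun :> V -> W;
  shom_linear : linear shom_fun;
  shom_even : forall i v, shom_fun (scomp i v) = scomp i (shom_fun v);
  shom_coact : forall v, coact (shom_fun v) = tmap shom_fun idfun (coact v)
}.

Definition siso (V W : supercomod B) : Prop := exists f : shom V W, bijective f.

Definition is_subrep (V W : supercomod B) : Prop :=
  exists f : shom V W, injective f.

Definition is_scalar_endo (V : supercomod B) (f : shom V V) : Prop :=
  exists c : K, forall v, f v = c *: v.

(** [P] is a sub-supercomodule: the coaction maps [P] into the image of
    [P (x) B]. *)
Definition subcomod (V : supercomod B) (P : V -> Prop) : Prop :=
  [/\ P 0,
      forall a v w, P v -> P w -> P (a *: v + w),
      forall i v, P v -> P (scomp i v) &
      forall v, P v -> exists2 s : seq (V * B),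
        (forall p, p \in s -> P p.1) &
        coact v = \sum_(p <- s) pure p.1 p.2].

Definition irreducible (V : supercomod B) : Prop :=
  (exists v : V, v != 0) /\
  forall P : V -> Prop, subcomod P ->
    (forall v, P v -> v = 0) \/ (forall v, P v).

(** Parity change: the grading is swapped and the coaction is unchanged (no sign
    occurs, the coaction being on the right). *)
Section Parity.
Variable V : supercomod B.

Fact pi_comp_comp i j (v : V) :
  scomp (~~ i) (scomp (~~ j) v) = if i == j then scomp (~~ j) v else 0.
Proof. by rewrite scomp_scomp (inj_eq negb_inj). Qed.

Fact pi_comp_sum (v : V) : scomp (~~ false) v + scomp (~~ true) v = v.
Proof. by rewrite addrC scomp_sum. Qed.

Definition pi_space : superspace K :=
  Superspace pi_comp_comp pi_comp_sum.

Fact pi_coact_even i (v : pi_space) :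
  coact (scomp (~~ i) (v : V)) = @tcomp K pi_space B i (coact (v : V)).
Proof. by rewrite coact_even /tcomp /= negbK addrC. Qed.

Definition Pi : supercomod B :=
  @Supercomod K B pi_space (@coact K B V) pi_coact_even
    (@coactA K B V) (@coact1 K B V).

End Parity.

Section HomModule.
Variables V W : supercomod B.

HB.instance Definition _ := gen_eqMixin (shom V W).
HB.instance Definition _ := gen_choiceMixin (shom V W).

Lemma shom_eq (f g : shom V W) : (forall v, f v = g v) -> f = g.
Proof.
case: f g => [f fl fe fc] [g gl ge gc] /= /funext fg; subst g.
by congr Shom; apply: Prop_irrelevance.
Qed.

Fact shom_zero_linear : linear (fun _ : V => 0 : W).
Proof. by move=> a x y; rewrite scaler0 addr0. Qed.
Fact shom_zero_even i (v : V) : (0 : W) = scomp i (0 : W).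
Proof. by rewrite linear0. Qed.
Fact shom_zero_coact (v : V) :
  coact (0 : W) = tmap (fun _ : V => 0 : W) idfun (coact v).
Proof.
rewrite linear0; move: (coact v); apply: tens_ext.
- by move=> a x y; rewrite scaler0 addr0.
- exact: tmap_linear shom_zero_linear (@linear_id _ _).
move=> u b; rewrite (tmap_pure _ _ shom_zero_linear) //.
have [pl _] := pure_bilin W B.
by have := pl b (-1) 0 0; rewrite scaler0 addr0 scaleN1r addNr => ->.
Qed.
Definition shom_zero := Shom shom_zero_linear shom_zero_even shom_zero_coact.

(** [a f + g] *)
Section Comb.
Variables (a : K) (f g : shom V W).
Fact shom_comb_linear : linear (fun v => a *: f v + g v).
Proof.
move=> b x y; rewrite !shom_linear !scalerDr !scalerA [a * b]mulrC.
by rewrite addrACA.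
Qed.
Fact shom_comb_even i v :
  a *: f (scomp i v) + g (scomp i v) = scomp i (a *: f v + g v).
Proof. by rewrite linearP !shom_even. Qed.
Fact shom_comb_coact v :
  coact (a *: f v + g v) = tmap (fun v => a *: f v + g v) idfun (coact v).
Proof.
rewrite linearP !shom_coact; move: (coact v); apply: tens_ext.
- apply: linear_add; last exact: tmap_linear (@shom_linear _ _ g) (@linear_id _ _).
  apply: linear_comp; first exact: tmap_linear (@shom_linear _ _ f) (@linear_id _ _).
  by move=> b x y; rewrite scalerDr !scalerA mulrC.
- exact: tmap_linear shom_comb_linear (@linear_id _ _).
move=> u b; rewrite !tmap_pure //; [|exact: shom_comb_linear|exact: shom_linear..].
by have [pl _] := pure_bilin W B; rewrite pl.
Qed.
Definition shom_comb := Shom shom_comb_linear shom_comb_even shom_comb_coact.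
End Comb.

Definition shom_add f g := shom_comb 1 f g.
Definition shom_scale a f := shom_comb a f shom_zero.
Definition shom_opp f := shom_scale (-1) f.

Fact shom_addA : associative shom_add.
Proof. by move=> f g h; apply: shom_eq => v /=; rewrite !scale1r addrA. Qed.
Fact shom_addC : commutative shom_add.
Proof. by move=> f g; apply: shom_eq => v /=; rewrite !scale1r addrC. Qed.
Fact shom_add0 : left_id shom_zero shom_add.
Proof. by move=> f; apply: shom_eq => v /=; rewrite scale1r add0r. Qed.
Fact shom_addN : left_inverse shom_zero shom_opp shom_add.
Proof.
by move=> f; apply: shom_eq => v /=; rewrite scale1r addr0 scaleN1r addNr.
Qed.
HB.instance Definition _ := GRing.isZmodule.Build (shom V W)
  shom_addA shom_addC shom_add0 shom_addN.

Lemma shom_addE (f g : shom V W) v : (f + g) v = f v + g v.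
Proof. by rewrite /= scale1r. Qed.

Fact shom_scaleA a b f : shom_scale a (shom_scale b f) = shom_scale (a * b) f.
Proof. by apply: shom_eq => v /=; rewrite !addr0 scalerA. Qed.
Fact shom_scale1 : left_id 1 shom_scale.
Proof. by move=> f; apply: shom_eq => v /=; rewrite addr0 scale1r. Qed.
Fact shom_scaleDr : right_distributive shom_scale +%R.
Proof.
by move=> a f g; apply: shom_eq => v; rewrite shom_addE /= !addr0 scale1r scalerDr.
Qed.
Fact shom_scaleDl f : {morph shom_scale^~ f : a b / a + b}.
Proof. by move=> a b; apply: shom_eq => v; rewrite shom_addE /= !addr0 scalerDl. Qed.
HB.instance Definition _ := GRing.Zmodule_isLmodule.Build K (shom V W)
  shom_scaleA shom_scale1 shom_scaleDr shom_scaleDl.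

Lemma shom_scaleE a (f : shom V W) v : (a *: f) v = a *: f v.
Proof. by rewrite /= addr0. Qed.

End HomModule.
End Hom.

(** Extension of scalars of a vector space along [phi : K -> K'], that is,
    [K' (x)_K U] *)
Section ExtensionOfScalars.
Variables (K K' : fieldType) (phi : {rmorphism K -> K'}).

Section Space.
Variable U : lmodType K.

Definition ext : lmodType K' := univ (fun Z (f : U -> Z) => semilinear phi f).

Definition ext_in (u : U) : ext := univ_in _ u.

Lemma ext_in_semilinear : semilinear phi ext_in.
Proof.
move=> a x y; apply: univ_eq => Z f Cf; rewrite lift_linear // !lift_in //.
Qed.

(** [ext_lift f] has no meaning when [f] is not semilinear. *)
Definition ext_lift (Z : lmodType K') (f : U -> Z) (x : ext) : Z := lift f x.

Lemma ext_lift_in (Z : lmodType K') (f : U -> Z) u :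
  semilinear phi f -> ext_lift f (ext_in u) = f u.
Proof. by move=> fl; apply: lift_in. Qed.

Lemma ext_lift_linear (Z : lmodType K') (f : U -> Z) :
  semilinear phi f -> linear (ext_lift f).
Proof. by move=> fl; apply: lift_linear. Qed.

Lemma ext_ext (Z : lmodType K') (f g : ext -> Z) :
  linear f -> linear g -> (forall u, f (ext_in u) = g (ext_in u)) ->
  forall x, f x = g x.
Proof. exact: univ_ext. Qed.

End Space.

Section Superspace.
Variable U : superspace K.

Definition ext_comp_fun (i : bool) : ext U -> ext U :=
  ext_lift (fun u => ext_in (scomp i u)).

Fact ext_comp_semilinear i : semilinear phi (fun u : U => ext_in (scomp i u)).
Proof. by move=> a x y; rewrite linearP ext_in_semilinear. Qed.

Definition ext_comp i : {linear ext U -> ext U} :=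
  mk_linear (ext_lift_linear (ext_comp_semilinear i)).

Lemma ext_comp_in i u : ext_comp i (ext_in u) = ext_in (scomp i u).
Proof. exact: (ext_lift_in _ (ext_comp_semilinear i)). Qed.

Lemma ext_in0 (W : lmodType K) : ext_in (0 : W) = 0.
Proof.
have := ext_in_semilinear (-1) (0 : W) 0.
by rewrite scaler0 addr0 rmorphN1 scaleN1r addNr.
Qed.

Lemma ext_inD (W : lmodType K) (x y : W) : ext_in (x + y) = ext_in x + ext_in y.
Proof. by have := ext_in_semilinear 1 x y; rewrite rmorph1 !scale1r. Qed.

Fact ext_comp_comp i j x :
  ext_comp i (ext_comp j x) = if i == j then ext_comp j x else 0.
Proof.
move: x; apply: ext_ext => [||u].
- by move=> a x y; rewrite !linearP.
- by case: (i == j) => a x y; rewrite ?linearP // scaler0 addr0.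
by rewrite !ext_comp_in scomp_scomp; case: ifP; rewrite // ext_in0.
Qed.

Fact ext_comp_sum x : ext_comp false x + ext_comp true x = x.
Proof.
move: x; apply: ext_ext => [||u].
- by apply: linear_add => a x y; rewrite linearP.
- by [].
by rewrite !ext_comp_in -ext_inD scomp_sum.
Qed.

Definition ext_space : superspace K' := Superspace ext_comp_comp ext_comp_sum.

End Superspace.

Section Transport.
Variables (V W : superspace K) (V' W' : superspace K').
Variables (p : V -> V') (q : W -> W').
Hypotheses (p_lin : semilinear phi p) (q_lin : semilinear phi q).
Hypotheses (p_even : forall i v, p (scomp i v) = scomp i (p v)).
Hypotheses (q_even : forall i w, q (scomp i w) = scomp i (q w)).

Lemma tmaps_tcomp i x :
  tmaps phi p q (tcomp i x) = tcomp i (tmaps phi p q x).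
Proof.
have pq_lin := tmaps_semilinear p_lin q_lin.
have tc_lin (j k : bool) (X Y : superspace K) :
    linear (tmap (@scomp _ X j) (@scomp _ Y k)).
  by apply: tmap_linear => a u v; rewrite linearP.
have tc_lin' (j k : bool) (X Y : superspace K') :
    linear (tmap (@scomp _ X j) (@scomp _ Y k)).
  by apply: tmap_linear => a u v; rewrite linearP.
move: x; apply: tens_semi_ext => [||v w].
- by apply: comp_semilinear => //; apply: linear_add.
- by apply: semilinear_comp => //; apply: linear_add.
rewrite /tcomp !tmap_pure //; try by move=> a u z; rewrite linearP.
have := pq_lin 1 (pure (scomp false v) (scomp i w))
  (pure (scomp true v) (scomp (~~ i) w)).
rewrite rmorph1 !scale1r => ->.
rewrite !tmaps_pure // !tmap_pure ?p_even ?q_even //;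
  by move=> a u z; rewrite linearP.
Qed.

Variables (rho : {linear V -> tens V W}) (rho' : {linear V' -> tens V' W'}).
Variables (D : {linear W -> tens W W}) (D' : {linear W' -> tens W' W'}).
Hypothesis rho_p : forall v, rho' (p v) = tmaps phi p q (rho v).
Hypothesis D_q : forall w, D' (q w) = tmaps phi q q (D w).

Let qq_lin : semilinear phi (tmaps phi q q).
Proof. exact: tmaps_semilinear. Qed.

Let pq_lin : semilinear phi (tmaps phi p q).
Proof. exact: tmaps_semilinear. Qed.

Let pqq_lin : semilinear phi (tmaps phi p (tmaps phi q q)).
Proof. exact: tmaps_semilinear. Qed.

Lemma tmaps_assoc x w :
  tassoc (pure (tmaps phi p q x) (q w)) =
  tmaps phi p (tmaps phi q q) (tassoc (pure x w)).
Proof.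
have [pl _] := pure_bilin (tens V W) W.
have [pl' _] := pure_bilin (tens V' W') W'.
move: x; apply: tens_semi_ext => [||v b].
- by apply: semilinear_comp; [apply: semilinear_comp pq_lin (pl' _)|exact: tassoc_linear].
- apply: comp_semilinear pqq_lin; apply: linear_comp (pl _) _; exact: tassoc_linear.
by rewrite tmaps_pure // !tassoc_pure !tmaps_pure.
Qed.

Lemma tmaps_coassocl x :
  tassoc (tmap rho' idfun (tmaps phi p q x)) =
  tmaps phi p (tmaps phi q q) (tassoc (tmap rho idfun x)).
Proof.
have rl' : linear (tmap rho' (@idfun W')) by apply: tmap_linear => // a u v; rewrite linearP.
have rl : linear (tmap rho (@idfun W)) by apply: tmap_linear => // a u v; rewrite linearP.
move: x; apply: tens_semi_ext => [||v w].
- by apply: semilinear_comp; [apply: semilinear_comp pq_lin rl'|exact: tassoc_linear].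
- apply: comp_semilinear pqq_lin; apply: linear_comp rl _; exact: tassoc_linear.
rewrite tmaps_pure // !tmap_pure //; try by move=> a u z; rewrite linearP.
by rewrite rho_p tmaps_assoc.
Qed.

Lemma tmaps_coassocr x :
  tmap idfun D' (tmaps phi p q x) =
  tmaps phi p (tmaps phi q q) (tmap idfun D x).
Proof.
have rl' : linear (tmap (@idfun V') D') by apply: tmap_linear => // a u v; rewrite linearP.
have rl : linear (tmap (@idfun V) D) by apply: tmap_linear => // a u v; rewrite linearP.
move: x; apply: tens_semi_ext => [||v w].
- exact: semilinear_comp pq_lin rl'.
- exact: comp_semilinear rl pqq_lin.
rewrite tmaps_pure // !tmap_pure //; try by move=> a u z; rewrite linearP.
by rewrite tmaps_pure // D_q.
Qed.

Variables (e : {scalar W}) (e' : {scalar W'}).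
Hypothesis e_q : forall w, e' (q w) = phi (e w).

Lemma scale_bilinr (L : fieldType) (X Y : lmodType L) (c : {scalar Y}) :
  bilin (fun (x : X) y => c y *: x).
Proof.
split=> [y|x] a u v; first by rewrite scalerDr !scalerA mulrC.
by rewrite linearP scalerDl scalerA.
Qed.

Lemma scale_bilinl (L : fieldType) (X Y : lmodType L) (c : {scalar X}) :
  bilin (fun x (y : Y) => c x *: y).
Proof. by have [l r] := scale_bilinr Y c; split. Qed.

Lemma tmaps_counitr x :
  tlift (fun v w => e' w *: v) (tmaps phi p q x) =
  p (tlift (fun v w => e w *: v) x).
Proof.
have b := @scale_bilinr K V W e; have b' := @scale_bilinr K' V' W' e'.
move: x; apply: tens_semi_ext => [||v w].
- exact: semilinear_comp pq_lin (tlift_linear b').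
- exact: comp_semilinear (tlift_linear b) p_lin.
rewrite tmaps_pure // !tlift_pure // e_q.
have := p_lin (e w) v 0.
have p0 : p 0 = 0.
  by have := p_lin (-1) 0 0; rewrite scaler0 addr0 rmorphN1 scaleN1r addNr.
by rewrite p0 !addr0.
Qed.

End Transport.

Lemma tmaps_counitl (W : lmodType K) (W' : lmodType K') (q : W -> W')
    (e : {scalar W}) (e' : {scalar W'}) x :
  semilinear phi q -> (forall w, e' (q w) = phi (e w)) ->
  tlift (fun v w => e' v *: w) (tmaps phi q q x) =
  q (tlift (fun v w => e v *: w) x).
Proof.
move=> q_lin e_q.
have b := @scale_bilinl K W W e; have b' := @scale_bilinl K' W' W' e'.
move: x; apply: tens_semi_ext => [||v w].
- exact: semilinear_comp (tmaps_semilinear q_lin q_lin) (tlift_linear b').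
- exact: comp_semilinear (tlift_linear b) q_lin.
rewrite tmaps_pure // !tlift_pure // e_q.
have := q_lin (e v) w 0.
have q0 : q 0 = 0.
  by have := q_lin (-1) 0 0; rewrite scaler0 addr0 rmorphN1 scaleN1r addNr.
by rewrite q0 !addr0.
Qed.

Section Coalgebra.
Variable B : supercoalg K.

Fact ext_comul_semilinear :
  semilinear phi (fun b : B => tmaps phi (@ext_in B) (@ext_in B) (comul b)).
Proof.
apply: comp_semilinear; first by move=> a x y; rewrite linearP.
by apply: tmaps_semilinear; exact: ext_in_semilinear.
Qed.

Definition ext_comul : {linear ext_space B -> tens (ext_space B) (ext_space B)} :=
  mk_linear (ext_lift_linear ext_comul_semilinear).

Lemma ext_comul_in b :
  ext_comul (ext_in b) = tmaps phi (@ext_in B) (@ext_in B) (comul b).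
Proof. exact: (ext_lift_in _ ext_comul_semilinear). Qed.

Fact ext_counit_semilinear :
  @semilinear K K' phi B K'^o (fun b : B => phi (counit b)).
Proof. by move=> a x y; rewrite linearP rmorphD rmorphM. Qed.

Definition ext_counit : {scalar ext_space B} :=
  mk_linear (ext_lift_linear ext_counit_semilinear).

Lemma ext_counit_in b : ext_counit (ext_in b) = phi (counit b).
Proof. exact: (ext_lift_in _ ext_counit_semilinear). Qed.

Let in_lin := @ext_in_semilinear B.

Let in_even i (b : B) :
  @ext_in B (scomp i b) = @scomp _ (ext_space B) i (ext_in b).
Proof. exact: esym (ext_comp_in _ _). Qed.

Lemma tcomp_linear (L : fieldType) (X Y : superspace L) i :
  linear (@tcomp L X Y i).
Proof.
by apply: linear_add; apply: tmap_linear => a u v; rewrite linearP.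
Qed.

Fact ext_comul_even i (a : ext_space B) :
  ext_comul (scomp i a) = tcomp i (ext_comul a).
Proof.
move: a; apply: ext_ext => [||b].
- by move=> c x y; rewrite !linearP.
- by apply: linear_comp (@tcomp_linear _ _ _ i) => c x y; rewrite linearP.
rewrite -in_even !ext_comul_in comul_even.
exact: (@tmaps_tcomp B B (ext_space B) (ext_space B)).
Qed.

Fact ext_counit_even (a : ext_space B) : ext_counit (scomp true a) = 0.
Proof.
move: a; apply: (@ext_ext B K'^o) => [||b].
- by move=> c x y; rewrite !linearP.
- by move=> c x y; rewrite scaler0 addr0.
by rewrite -in_even ext_counit_in counit_even rmorph0.
Qed.

Fact ext_comulA (a : ext_space B) :
  tassoc (tmap ext_comul idfun (ext_comul a)) =
  tmap idfun ext_comul (ext_comul a).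
Proof.
move: a; apply: ext_ext => [||b].
- apply: linear_comp (@tassoc_linear _ _ _ _).
  apply: (@linear_comp _ _ _ _ ext_comul); first by move=> c x y; rewrite linearP.
  by apply: tmap_linear => // c x y; rewrite linearP.
- apply: (@linear_comp _ _ _ _ ext_comul); first by move=> c x y; rewrite linearP.
  by apply: tmap_linear => // c x y; rewrite linearP.
rewrite ext_comul_in (@tmaps_coassocl B B (ext_space B) (ext_space B) _ _ _ _ comul) //;
  last exact: ext_comul_in.
rewrite (@tmaps_coassocr B B (ext_space B) (ext_space B) _ _ _ _ comul) //;
  last exact: ext_comul_in.
by rewrite comulA.
Qed.

Fact ext_counitl (a : ext_space B) :
  tlift (fun x y => ext_counit x *: y) (ext_comul a) = a.
Proof.
move: a; apply: ext_ext => [||b].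
- apply: (@linear_comp _ _ _ _ ext_comul); first by move=> c x y; rewrite linearP.
  exact/tlift_linear/scale_bilinl.
- exact: linear_id.
rewrite ext_comul_in (@tmaps_counitl _ _ _ counit) ?counitl //.
exact: ext_counit_in.
Qed.

Fact ext_counitr (a : ext_space B) :
  tlift (fun x y => ext_counit y *: x) (ext_comul a) = a.
Proof.
move: a; apply: ext_ext => [||b].
- apply: (@linear_comp _ _ _ _ ext_comul); first by move=> c x y; rewrite linearP.
  exact/tlift_linear/scale_bilinr.
- exact: linear_id.
rewrite ext_comul_in (@tmaps_counitr B B (ext_space B) (ext_space B) _ _ _ _ counit)
  ?counitr //.
exact: ext_counit_in.
Qed.

(** [K' (x)_K B]; for B the coordinate superalgebra of G, its supercomodules are
    the representations of the base change of G to K'. *)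
Definition ext_coalg : supercoalg K' :=
  Supercoalg ext_comul_even ext_counit_even ext_comulA ext_counitl ext_counitr.

End Coalgebra.

(** Homomorphisms of supercoalgebras that are semilinear along [phi] *)
Record coalg_map (B : supercoalg K) (B' : supercoalg K') := CoalgMap {
  cm_fun :> B -> B';
  cm_semilinear : semilinear phi cm_fun;
  cm_even : forall i b, cm_fun (scomp i b) = scomp i (cm_fun b);
  cm_comul : forall b, comul (cm_fun b) = tmaps phi cm_fun cm_fun (comul b);
  cm_counit : forall b, counit (cm_fun b) = phi (counit b)
}.

(** The base change of a representation along [phi] and [theta]:
    on [K' (x)_K V], the coaction sends [1 (x) v] to the image of
    [coact v] under [x (x) b |-> (1 (x) x) (x) theta b]. *)
Section Comodule.
Variables (B : supercoalg K) (B' : supercoalg K') (theta : coalg_map B B').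
Variable V : supercomod B.

Fact ext_coact_semilinear :
  semilinear phi (fun v : V => tmaps phi (@ext_in V) theta (coact v)).
Proof.
apply: comp_semilinear; first by move=> a x y; rewrite linearP.
by apply: tmaps_semilinear; [exact: ext_in_semilinear|exact: cm_semilinear].
Qed.

Definition ext_coact : {linear ext_space V -> tens (ext_space V) B'} :=
  mk_linear (ext_lift_linear ext_coact_semilinear).

Lemma ext_coact_in v :
  ext_coact (ext_in v) = tmaps phi (@ext_in V) theta (coact v).
Proof. exact: (ext_lift_in _ ext_coact_semilinear). Qed.

Let in_lin := @ext_in_semilinear V.
Let theta_lin := @cm_semilinear _ _ theta.

Let in_even i (v : V) :
  @ext_in V (scomp i v) = @scomp _ (ext_space V) i (ext_in v).
Proof. exact: esym (ext_comp_in _ _). Qed.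

Fact ext_coact_even i (x : ext_space V) :
  ext_coact (scomp i x) = tcomp i (ext_coact x).
Proof.
move: x; apply: ext_ext => [||v].
- by move=> c x y; rewrite !linearP.
- by apply: linear_comp (@tcomp_linear _ _ _ i) => c x y; rewrite linearP.
rewrite -in_even !ext_coact_in coact_even.
apply: (@tmaps_tcomp V B (ext_space V) B') => //; exact: cm_even.
Qed.

Fact ext_coactA (x : ext_space V) :
  tassoc (tmap ext_coact idfun (ext_coact x)) =
  tmap idfun (@comul K' B') (ext_coact x).
Proof.
move: x; apply: ext_ext => [||v].
- apply: linear_comp (@tassoc_linear _ _ _ _).
  apply: (@linear_comp _ _ _ _ ext_coact); first by move=> c x y; rewrite linearP.
  by apply: tmap_linear => // c x y; rewrite linearP.
- apply: (@linear_comp _ _ _ _ ext_coact); first by move=> c x y; rewrite linearP.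
  by apply: tmap_linear => // c x y; rewrite linearP.
rewrite ext_coact_in (@tmaps_coassocl V B (ext_space V) B' _ _ _ _ coact) //;
  last exact: ext_coact_in.
rewrite (@tmaps_coassocr V B (ext_space V) B' _ _ _ _ comul) //;
  last exact: cm_comul.
by rewrite coactA.
Qed.

Fact ext_coact1 (x : ext_space V) :
  tlift (fun y (b : B') => counit b *: y) (ext_coact x) = x.
Proof.
move: x; apply: ext_ext => [||v].
- apply: (@linear_comp _ _ _ _ ext_coact); first by move=> c x y; rewrite linearP.
  exact/tlift_linear/scale_bilinr.
- exact: linear_id.
rewrite ext_coact_in (@tmaps_counitr V B (ext_space V) B' _ _ _ _ counit)
  ?coact1 //.
exact: cm_counit.
Qed.

Definition ext_comod : supercomod B' :=
  Supercomod ext_coact_even ext_coactA ext_coact1.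

End Comodule.

Section Unit.
Variable B : supercoalg K.

Fact ext_in_even i b :
  @ext_in B (scomp i b) = @scomp _ (ext_coalg B) i (ext_in b).
Proof. exact: esym (ext_comp_in _ _). Qed.

Definition ext_unit : coalg_map B (ext_coalg B) :=
  @CoalgMap B (ext_coalg B) (@ext_in B) (@ext_in_semilinear B) ext_in_even
    (@ext_comul_in B) (@ext_counit_in B).

End Unit.
End ExtensionOfScalars.

Section Galois.
Variables (F L : fieldType) (iota : {rmorphism F -> L}).

Definition is_separable_closure : Prop :=
  (forall x : L, exists2 p : {poly F},
     separable_poly p & root (map_poly iota p) x) /\
  (forall p : {poly L}, separable_poly p -> (1 < size p)%N ->
     exists x, root p x).

Record absgal := AbsGal {
  gal_fun :> {rmorphism L -> L};
  gal_bij : bijective gal_fun;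
  gal_fix : forall x, gal_fun (iota x) = iota x
}.

(** For [s] in the Galois group, the s-semilinear automorphism
    [l (x) b |-> s l (x) b] of [L (x)_F B] *)
Section Twist.
Variables (s : absgal) (B : supercoalg F).

Definition gal_coalg_fun : ext_coalg iota B -> ext_coalg iota B :=
  @ext_lift F L iota B (restr s (ext_coalg iota B)) (@ext_in F L iota B).

Fact gal_in_semilinear :
  @semilinear F L iota B (restr s (ext_coalg iota B)) (@ext_in F L iota B).
Proof.
move=> a x y; rewrite ext_in_semilinear.
by rewrite -[in LHS](gal_fix s).
Qed.

Lemma gal_coalg_in b : gal_coalg_fun (ext_in iota b) = ext_in iota b.
Proof. exact: (ext_lift_in _ gal_in_semilinear). Qed.

Fact gal_coalg_semilinear : semilinear s gal_coalg_fun.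
Proof. exact: (ext_lift_linear gal_in_semilinear). Qed.

Lemma ext_semi_ext (U : lmodType F) (Z : lmodType L) (f g : ext iota U -> Z) :
  semilinear s f -> semilinear s g ->
  (forall u, f (ext_in iota u) = g (ext_in iota u)) -> forall x, f x = g x.
Proof. exact: (@ext_ext F L iota U (restr s Z)). Qed.

Fact gal_coalg_even i b :
  gal_coalg_fun (scomp i b) = scomp i (gal_coalg_fun b).
Proof.
move: b; apply: ext_semi_ext => [||b].
- by apply: comp_semilinear gal_coalg_semilinear => c x y; rewrite linearP.
- by apply: semilinear_comp gal_coalg_semilinear _ => c x y; rewrite linearP.
by rewrite -!ext_in_even !gal_coalg_in -!ext_in_even.
Qed.

Fact gal_coalg_comul b :
  comul (gal_coalg_fun b) = tmaps s gal_coalg_fun gal_coalg_fun (comul b).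
Proof.
have gl := gal_coalg_semilinear; have ggl := tmaps_semilinear gl gl.
move: b; apply: ext_semi_ext => [||b].
- by apply: semilinear_comp gl _ => c x y; rewrite linearP.
- by apply: comp_semilinear ggl => c x y; rewrite linearP.
rewrite gal_coalg_in [comul _]ext_comul_in; move: (comul b).
have il := @ext_in_semilinear F L iota B; have iil := tmaps_semilinear il il.
apply: tens_semi_ext => //.
- by move=> a x y; rewrite iil ggl gal_fix.
move=> x y; rewrite tmaps_pure // tmaps_pure //.
by rewrite !gal_coalg_in.
Qed.

Fact gal_coalg_counit b : counit (gal_coalg_fun b) = s (counit b).
Proof.
have gl := gal_coalg_semilinear.
move: b; apply: (@ext_semi_ext B L^o) => [||b].
- by apply: semilinear_comp gl _ => c x y; rewrite linearP.
- by move=> c x y; rewrite linearP rmorphD rmorphM.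
by rewrite gal_coalg_in [counit _]ext_counit_in gal_fix.
Qed.

Definition gal_coalg : coalg_map s (ext_coalg iota B) (ext_coalg iota B) :=
  CoalgMap gal_coalg_semilinear gal_coalg_even gal_coalg_comul gal_coalg_counit.

End Twist.

Variable B : supercoalg F.

(** [V (x)_F L], for a representation V over F *)
Definition base_change (V : supercomod B) : supercomod (ext_coalg iota B) :=
  ext_comod (ext_unit iota B) V.

(** The base change of a representation V over L along [s : L -> L] *)
Definition gal_twist (s : absgal) (V : supercomod (ext_coalg iota B)) :
    supercomod (ext_coalg iota B) :=
  ext_comod (gal_coalg s B) V.

Definition quasi_rational (V : supercomod (ext_coalg iota B)) : Prop :=
  [/\ irreducible V,
      forall f : shom V V, is_scalar_endo f &
      forall s : absgal, siso (gal_twist s V) V].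

Definition super_quasi_rational (V : supercomod (ext_coalg iota B)) : Prop :=
  [/\ irreducible V,
      forall f : shom V V, is_scalar_endo f &
      forall s : absgal, siso (gal_twist s V) V \/ siso (gal_twist s V) (Pi V)].

End Galois.

Definition two_sided_ideal (K : fieldType) (A : algType K) (I : A -> Prop) :
    Prop :=
  [/\ I 0, forall x y, I x -> I y -> I (x + y) &
      forall a x, I x -> I (a * x) /\ I (x * a)].

(** [A] is nonzero, being an [algType]. *)
Definition central_simple (K : fieldType) (A : algType K) : Prop :=
  [/\ exists n (e : 'I_n -> A), forall x,
        exists c : 'I_n -> K, x = \sum_(i < n) c i *: e i,
      forall z : A, (forall x, z * x = x * z) -> exists c : K, z = c%:A &
      forall I : A -> Prop, two_sided_ideal I ->
        (forall x, I x -> x = 0) \/ (forall x, I x)].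

Variant sign := Plus | Minus.

(** [Plus] when D is central simple as an ordinary (ungraded) algebra *)
Definition superalg_sign (K : fieldType) (D : superalg K) : sign :=
  if `[< central_simple D >] then Plus else Minus.

Section Composition.
Variables (K : fieldType) (B : supercoalg K).

Section Comp.
Variables (U V W : supercomod B) (g : shom V W) (f : shom U V).
Fact shom_comp_linear : linear (fun u => g (f u)).
Proof. exact: linear_comp (shom_linear f) (shom_linear g). Qed.
Fact shom_comp_even i u : g (f (scomp i u)) = scomp i (g (f u)).
Proof. by rewrite !shom_even. Qed.
Fact shom_comp_coact u :
  coact (g (f u)) = tmap (fun u => g (f u)) idfun (coact u).
Proof.
have fl := tmap_linear (shom_linear f) (@linear_id _ B).
have gl := tmap_linear (shom_linear g) (@linear_id _ B).
rewrite !shom_coact; move: (coact u); apply: tens_ext => [||x b].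
- exact: linear_comp fl gl.
- exact: tmap_linear shom_comp_linear (@linear_id _ B).
by rewrite !tmap_pure //; [exact: shom_comp_linear|exact: (shom_linear g)|exact: (shom_linear f)].
Qed.
Definition shom_comp := Shom shom_comp_linear shom_comp_even shom_comp_coact.
End Comp.

Fact shom_id_coact (V : supercomod B) (v : V) :
  coact v = tmap (fun v : V => v) idfun (coact v).
Proof.
move: (coact v); apply: tens_ext => [||x b].
- exact: linear_id.
- exact: tmap_linear (@linear_id _ V) (@linear_id _ B).
by rewrite tmap_pure.
Qed.

Definition shom_id (V : supercomod B) : shom V V :=
  Shom (@linear_id K V) (fun i v => erefl) (@shom_id_coact V).

Definition shom_pi (V W : supercomod B) (f : shom V W) : shom (Pi V) (Pi W) :=
  @Shom K B (Pi V) (Pi W) f (shom_linear f)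
    (fun i v => shom_even f (~~ i) v) (shom_coact f).

Fact shom_unpi_even (V W : supercomod B) (f : shom V (Pi (Pi W))) i (v : V) :
  f (scomp i v) = scomp i (f v : W).
Proof. by rewrite shom_even /= negbK. Qed.

Definition shom_unpi (V W : supercomod B) (f : shom V (Pi (Pi W))) : shom V W :=
  @Shom K B V W f (shom_linear f) (shom_unpi_even f) (shom_coact f).

End Composition.

(** The superalgebra with even part Hom(V, V) and odd part Hom(V, Pi V).  V, Pi V
    and Pi (Pi V) have the same underlying vector space, so that all products are
    compositions of maps.  V is required to be nonzero because an [algType] is. *)
Section SuperEnd.
Variables (K : fieldType) (B : supercoalg K) (V : supercomod B).
Variable V_neq0 : exists v : V, v != 0.

Definition super_end (_ : exists v : V, v != 0) : Type :=
  (shom V V * shom V (Pi V))%type.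

Local Notation E := (super_end V_neq0).

HB.instance Definition _ := GRing.Lmodule.copy E (shom V V * shom V (Pi V))%type.

Definition super_end_one : E := (shom_id V, 0).

Definition super_end_mul (f g : E) : E :=
  (shom_comp f.1 g.1 + shom_unpi (shom_comp (shom_pi f.2) g.2),
   shom_comp (shom_pi f.1) g.2 + shom_comp f.2 g.1).

Lemma super_end_eq (f g : E) :
  (forall v, f.1 v = g.1 v) -> (forall v, f.2 v = g.2 v) -> f = g.
Proof.
case: f g => [f0 f1] [g0 g1] /= h0 h1.
by congr pair; apply: shom_eq.
Qed.

Lemma shomD (V1 V2 : supercomod B) (f : shom V1 V2) x y : f (x + y) = f x + f y.
Proof. by have := shom_linear f 1 x y; rewrite !scale1r. Qed.

Lemma super_end_mul1E f g v :
  (super_end_mul f g).1 v = f.1 (g.1 v) + f.2 (g.2 v).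
Proof. exact: shom_addE. Qed.

Lemma super_end_mul2E f g v :
  (super_end_mul f g).2 v = f.1 (g.2 v) + f.2 (g.1 v).
Proof. exact: shom_addE. Qed.

Let ev1D (f : E) (x y : V) : f.1 (x + y) = f.1 x + f.1 y.
Proof. exact: shomD. Qed.
Let ev2D (f : E) (x y : V) : f.2 (x + y) = (f.2 x : V) + f.2 y.
Proof. exact: (shomD f.2). Qed.

Fact super_end_mulA : associative super_end_mul.
Proof.
move=> f g h; apply: super_end_eq => v.
  rewrite !super_end_mul1E !super_end_mul2E ev1D ev2D.
  by rewrite [X in _ + X]addrC addrACA.
rewrite [LHS]super_end_mul2E [RHS]super_end_mul2E.
rewrite !super_end_mul1E !super_end_mul2E ev1D ev2D.
by rewrite [X in _ + X]addrC addrACA.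
Qed.

Fact super_end_mul1r : left_id super_end_one super_end_mul.
Proof.
move=> f; apply: super_end_eq => v.
  by rewrite super_end_mul1E /= addr0.
by rewrite super_end_mul2E /= addr0.
Qed.

Fact super_end_mulr1 : right_id super_end_one super_end_mul.
Proof.
have s0 (W : supercomod B) (f : shom V W) : f 0 = 0.
  by have := shom_linear f (-1) 0 0; rewrite !scaleN1r oppr0 addr0 addNr.
move=> f; apply: super_end_eq => v.
  by rewrite super_end_mul1E /= (s0 _ f.2) addr0.
by rewrite super_end_mul2E /= (s0 _ f.1) add0r.
Qed.

Let add1E (f g : E) v : (f + g).1 v = f.1 v + g.1 v.
Proof. exact: shom_addE. Qed.
Let add2E (f g : E) v : (f + g).2 v = f.2 v + g.2 v.
Proof. exact: shom_addE. Qed.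

Fact super_end_mulDl : left_distributive super_end_mul +%R.
Proof.
move=> f g h; apply: super_end_eq => v.
  by rewrite add1E !super_end_mul1E add1E add2E addrACA.
by rewrite add2E !super_end_mul2E add1E add2E addrACA.
Qed.

Fact super_end_mulDr : right_distributive super_end_mul +%R.
Proof.
move=> f g h; apply: super_end_eq => v.
  by rewrite add1E !super_end_mul1E add1E add2E ev1D ev2D addrACA.
by rewrite add2E !super_end_mul2E add1E add2E ev1D ev2D addrACA.
Qed.

Fact super_end_1neq0 : super_end_one != 0.
Proof.
have [v v0] := V_neq0; apply/eqP => /(congr1 fst) /(congr1 (fun f => shom_fun f v)) /=.
exact/eqP.
Qed.

HB.instance Definition _ := GRing.Zmodule_isNzRing.Build E
  super_end_mulA super_end_mul1r super_end_mulr1 super_end_mulDl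
  super_end_mulDr super_end_1neq0.

Lemma super_endM1 (f g : E) v : (f * g).1 v = f.1 (g.1 v) + f.2 (g.2 v).
Proof. exact: super_end_mul1E. Qed.
Lemma super_endM2 (f g : E) v : (f * g).2 v = f.1 (g.2 v) + f.2 (g.1 v).
Proof. exact: super_end_mul2E. Qed.

Let scale1E a (f : E) v : (a *: f).1 v = a *: f.1 v.
Proof. exact: shom_scaleE. Qed.
Let scale2E a (f : E) v : (a *: f).2 v = a *: f.2 v.
Proof. exact: shom_scaleE. Qed.

Fact super_end_scaleAl (a : K) (f g : E) : a *: (f * g) = (a *: f) * g.
Proof.
apply: super_end_eq => v.
  by rewrite scale1E !super_endM1 scale1E scale2E scalerDr.
by rewrite scale2E !super_endM2 scale1E scale2E scalerDr.
Qed.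

HB.instance Definition _ :=
  GRing.Lmodule_isLalgebra.Build K E super_end_scaleAl.

Let sZ (W : supercomod B) (f : shom V W) (a : K) (v : V) : f (a *: v) = a *: f v.
Proof.
have f0 : f 0 = 0.
  by have := shom_linear f (-1) 0 0; rewrite !scaleN1r oppr0 addr0 addNr.
by have := shom_linear f a v 0; rewrite f0 !addr0.
Qed.

Fact super_end_scaleAr (a : K) (f g : E) : a *: (f * g) = f * (a *: g).
Proof.
apply: super_end_eq => v.
  by rewrite scale1E !super_endM1 scale1E scale2E scalerDr (sZ f.1) (sZ f.2).
by rewrite scale2E !super_endM2 scale1E scale2E scalerDr (sZ f.1) (sZ f.2).
Qed.

HB.instance Definition _ := GRing.Lalgebra_isAlgebra.Build K E super_end_scaleAr.

Definition super_end_comp_fun (i : bool) (f : E) : E :=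
  if i then (0, f.2) else (f.1, 0).

Fact super_end_comp_linear i : linear (super_end_comp_fun i).
Proof.
by move=> a f g; case: i; apply/pair_equal_spec; split; rewrite //= scaler0 addr0.
Qed.

Definition super_end_comp i : {linear E -> E} :=
  mk_linear (super_end_comp_linear i).

Fact super_end_comp_comp i j f :
  super_end_comp i (super_end_comp j f) =
  if i == j then super_end_comp j f else 0.
Proof. by case: i j => [] []. Qed.

Fact super_end_comp_sum f : super_end_comp false f + super_end_comp true f = f.
Proof. by case: f => f0 f1; congr pair; rewrite /= ?addr0 ?add0r. Qed.

Fact super_end_comp_mul i j f g :
  super_end_comp (i (+) j) (super_end_comp i f * super_end_comp j g) =
  super_end_comp i f * super_end_comp j g.
Proof.
have s0 (W : supercomod B) (h : shom V W) : h 0 = 0.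
  by have := shom_linear h (-1) 0 0; rewrite !scaleN1r oppr0 addr0 addNr.
apply: super_end_eq => v; case: i j => [] [] //=;
  by rewrite ?(s0 _ f.1) ?(s0 _ f.2) scaler0 addr0.
Qed.

Definition super_end_superalg : superalg K :=
  Superalg super_end_comp_comp super_end_comp_sum super_end_comp_mul.

End SuperEnd.

Definition epsilon (K : fieldType) (B : supercoalg K) (V : supercomod B)
    (V_irr : irreducible V) : sign :=
  superalg_sign (super_end_superalg (proj1 V_irr)).

(* Main.v *)
Require Import Defs.
From HB Require Import structures.
From mathcomp Require Import all_boot all_algebra all_field.
From mathcomp Require Import boolp.
From mathcomp Require classical_sets.
Set Implicit Arguments.
Unset Strict Implicit.
Unset Printing Implicit Defensive.
Import GRing.Theory.
Local Open Scope ring_scope.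

(** The supercomodules of a coalgebra are handled as modules over its dual
    algebra, whose elements act by [act beta].  Let [W = L (x) V_F].  The sum of
    the images of the homogeneous maps [V -> W] is Galois stable, because every
    conjugate of [V] is [V] or [Pi V]; by Galois descent it comes from a
    subrepresentation of [V_F], so it is [W].  Hence [W] is a finite direct sum of
    copies of [V], up to parity, and [id_W = \sum_i g_i p_i] with [g_i : V -> W]
    and [p_i : W -> V] colinear.  Moreover [End(W) = L (x) D], all the
    endomorphisms being ungraded, so [D] has center [F] if and only if [End(W)] has
    center [L].  If [V] is not isomorphic to [Pi V], the ungraded endomorphisms of
    [V] are scalars, and so is every central endomorphism of [W].  If [eps : V -> V]
    is an odd isomorphism, it commutes with all of [End(V)], and
    [\sum_i g_i eps p_i] is central in [End(W)] without being a scalar.  Finally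
    a division superalgebra of finite dimension whose ungraded center is [F] is
    simple as an ungraded algebra. *)

(** * Linear algebra in infinite dimension *)

(** Zorn's lemma on the subtype of good predicates above [A0]. The empty chain is bounded by [A0]
    itself, so closure under unions is asked of nonempty chains only. *)
Lemma zorn_predicate (X : Type) (good : (X -> Prop) -> Prop) (A0 : X -> Prop) :
  good A0 ->
  (forall C : (X -> Prop) -> Prop,
     (exists A, C A) -> (forall A, C A -> good A) ->
     (forall A B, C A -> C B -> (forall x, A x -> B x) \/ (forall x, B x -> A x)) ->
     good (fun x => exists2 A, C A & A x)) ->
  exists M, [/\ good M, forall x, A0 x -> M x &
    forall N, good N -> (forall x, M x -> N x) -> forall x, N x -> M x].
Proof.
move=> gA0 gU.
pose T := {A : X -> Prop | good A /\ forall x, A0 x -> A x}.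
pose R (A B : T) := `[< forall x, sval A x -> sval B x >].
have [] := @classical_sets.ZL_preorder T (exist _ A0 (conj gA0 (fun x h => h))) R.
- by move=> A; apply/asboolP.
- by move=> A B C /asboolP AB /asboolP BC; apply/asboolP => x /AB/BC.
- move=> C Cchain.
  have [[A CA]|nC] := pselect (exists A, C A); last first.
    exists (exist _ A0 (conj gA0 (fun x h => h))) => B CB.
    by case: nC; exists B.
  pose D (B : X -> Prop) := exists2 B', C B' & sval B' = B.
  have gD : good (fun x => exists2 B, D B & B x).
    apply: gU; first by exists (sval A), A.
      by move=> _ [B _ <-]; case: (svalP B).
    move=> _ _ [B CB <-] [B' CB' <-].
    by case: (Cchain _ _ CB CB') => /asboolP; [left|right].
  have sD x : A0 x -> exists2 B, D B & B x.
    move=> A0x; exists (sval A); first by exists A.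
    by case: (svalP A) => _; apply.
  pose U : T := exist _ (fun x => exists2 B, D B & B x) (conj gD sD).
  exists U => B CB; apply/asboolP => x Bx /=.
  by exists (sval B) => //; exists B.
move=> -[M [gM A0M]] Mmax; exists M; split=> //.
move=> N gN MN.
have sN x : A0 x -> N x by move=> /A0M/MN.
have /asboolP NM : R (exist _ N (conj gN sN)) (exist _ M (conj gM A0M)).
  by apply: Mmax; apply/asboolP.
exact: NM.
Qed.

Lemma scalar_Z (K : fieldType) (U : lmodType K) (f : {scalar U}) a x :
  f (a *: x) = a * f x.
Proof. by rewrite linearZ. Qed.

Lemma scalar_D (K : fieldType) (U : lmodType K) (f : {scalar U}) x y :
  f (x + y) = f x + f y.
Proof. by rewrite linearD. Qed.

Section Functionals.
Variables (K : fieldType) (M : lmodType K).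

(** By Zorn there is a maximal subspace [Q] that contains [P] and misses [b]. Maximality makes [Q] a
    complement of the line of [b], and [beta] is the coordinate along that line. *)
Lemma separating_functional (P : M -> Prop) (b : M) :
  P 0 -> (forall a x y, P x -> P y -> P (a *: x + y)) -> ~ P b ->
  exists2 beta : {scalar M}, forall x, P x -> beta x = 0 & beta b = 1.
Proof.
move=> P0 Plin nPb.
pose good (Q : M -> Prop) :=
  [/\ Q 0, forall a x y, Q x -> Q y -> Q (a *: x + y) & ~ Q b].
have [||Q [[Q0 Ql nQb] PQ Qmax]] := @zorn_predicate M good P.
- by [].
- move=> C [A CA] Cg Cc; split.
  - by exists A => //; have [] := Cg _ CA.
  - move=> a x y [B CB Bx] [D CD Dy].
    have [BD|DB] := Cc _ _ CB CD.
      by exists D => //; have [_ h _] := Cg _ CD; apply: h => //; apply: BD.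
    by exists B => //; have [_ h _] := Cg _ CB; apply: h => //; apply: DB.
  - by move=> [B CB Bb]; have [_ _] := Cg _ CB.
have QZ a x : Q x -> Q (a *: x) by move=> Qx; rewrite -[_ *: _]addr0; apply: Ql.
have QB x y : Q x -> Q y -> Q (x - y).
  by move=> Qx Qy; rewrite addrC -scaleN1r; apply: Ql.
(* [N] is the sum of [Q] and the line of [x]. If it misses [b], maximality puts [x] in [Q];
   otherwise [b - c *: x] is in [Q] with [c] nonzero, and this is solved for [x]. *)
have dec x : exists c, Q (x - c *: b).
  pose N y := exists c, Q (y - c *: x).
  have [Qx|nQx] := pselect (Q x); first by exists 0; rewrite scale0r subr0.
  have Nlin a u v : N u -> N v -> N (a *: u + v).
    move=> [c Qc] [d Qd]; exists (a * c + d).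
    rewrite scalerDl opprD addrACA -scalerA -scalerBr; exact: Ql.
  have QN y : Q y -> N y by move=> Qy; exists 0; rewrite scale0r subr0.
  have [[c Qc]|nNb] := pselect (N b); last first.
    case: nQx; apply: (Qmax N) => //; first by split; [exact: QN| |].
    by exists 1; rewrite scale1r subrr.
  have c0 : c != 0.
    by apply/eqP => c0; move: Qc; rewrite c0 scale0r subr0.
  exists c^-1; have := QZ (- c^-1) _ Qc.
  by rewrite scalerBr scalerA mulNr mulVf // !scaleNr scale1r opprK addrC.
have uniq_c x c d : Q (x - c *: b) -> Q (x - d *: b) -> c = d.
  move=> Qc Qd; apply/eqP; rewrite -subr_eq0; apply/negP => /negP cd.
  case: nQb; have := QZ (c - d)^-1 _ (QB _ _ Qd Qc).
  have -> : x - d *: b - (x - c *: b) = (c - d) *: b.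
    by rewrite opprB addrC addrA addrNK scalerBl.
  by rewrite scalerA mulVf // scale1r.
have [f fP] := choice dec.
have fl : @linear_for K M K *%R f.
  move=> a x y; apply: (uniq_c (a *: x + y)) => //.
  rewrite scalerDl opprD addrACA -[(a * f x) *: b]scalerA -scalerBr; exact: Ql.
exists (mk_linear (Z := K^o) fl) => [x Px|] /=.
  by apply: (uniq_c x) => //; rewrite scale0r subr0; exact: PQ.
by apply: (uniq_c b) => //; rewrite scale1r subrr.
Qed.

Lemma nonvanishing_functional (x : M) : x != 0 -> exists beta : {scalar M}, beta x = 1.
Proof.
move=> x0; have [|||beta _ bx] := @separating_functional (fun y => y = 0) x.
- by [].
- by move=> a u v -> ->; rewrite scaler0 addr0.
- by apply/eqP.
- by exists beta.
Qed.

(** This replaces the choice of a basis. *)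
Lemma finite_rank_identity (bs : seq M) :
  exists T : seq ({scalar M} * M),
    forall b, b \in bs -> b = \sum_(p <- T) p.1 b *: p.2.
Proof.
elim: bs => [|b bs [T hT]]; first by exists [::].
pose t x := \sum_(p <- T) p.1 x *: p.2.
have tl a x y : t (a *: x + y) = a *: t x + t y.
  rewrite /t scaler_sumr -big_split /=; apply: eq_bigr => p _.
  by rewrite linearP scalerDl scalerA.
have [tb|tb] := pselect (t b = b).
  by exists T => x; rewrite inE => /predU1P[->|/hT].
have [|||beta b0 b1] := @separating_functional (fun x => t x = x) b.
- by have := tl (-1) 0 0; rewrite scaler0 addr0 scaleN1r addNr.
- by move=> a x y tx ty; rewrite tl tx ty.
- exact: tb.
(* The new term corrects [t] at [b], where [beta] is 1, and changes nothing on the vectors fixed by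
   [t], where [beta] vanishes. *)
exists ((beta, b - t b) :: T) => x; rewrite inE big_cons -/(t x) /=.
move=> /predU1P[->|xs]; first by rewrite b1 scale1r addrNK.
by rewrite b0 ?scale0r ?add0r; [exact: hT|exact: esym (hT _ xs)].
Qed.

End Functionals.

Section Contraction.
Variables (K : fieldType) (B : lmodType K).
Implicit Types beta gamma delta : {scalar B}.

Definition contr (V : lmodType K) beta (x : tens V B) : V :=
  tlift (fun v b => beta b *: v) x.

Lemma contr_linear (V : lmodType K) beta : linear (@contr V beta).
Proof. exact/tlift_linear/scale_bilinr. Qed.

Lemma contr_pure (V : lmodType K) beta (v : V) b :
  contr beta (pure v b) = beta b *: v.
Proof. exact/tlift_pure/scale_bilinr. Qed.

Lemma linear_bigsum (U V : lmodType K) (f : U -> V) I (r : seq I) (F : I -> U) :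
  linear f -> f (\sum_(i <- r) F i) = \sum_(i <- r) f (F i).
Proof. by move=> fl; exact: (linear_sum (mk_linear fl)). Qed.

Lemma linear_0 (U V : lmodType K) (f : U -> V) : linear f -> f 0 = 0.
Proof. by move=> fl; exact: (linear0 (mk_linear fl)). Qed.

Lemma linear_D (U V : lmodType K) (f : U -> V) x y :
  linear f -> f (x + y) = f x + f y.
Proof. by move=> fl; exact: (linearD (mk_linear fl)). Qed.

Lemma linear_Z (U V : lmodType K) (f : U -> V) a x :
  linear f -> f (a *: x) = a *: f x.
Proof. by move=> fl; have := fl a x 0; rewrite (linear_0 fl) !addr0. Qed.

Lemma tens_pure_sum (V : lmodType K) (x : tens V B) :
  exists s : seq (V * B), x = \sum_(p <- s) pure p.1 p.2.
Proof.
exists [seq (p.1 *: p.2.1, p.2.2) | p <- univ_repr x].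
rewrite big_map {1}(univ_sum x); apply: eq_bigr => -[a [v b]] _ /=.
by have [pl _] := pure_bilin V B; rewrite (linear_Z _ _ (pl b)).
Qed.

Lemma contr_sum (V : lmodType K) beta I (r : seq I) (F : I -> tens V B) :
  contr beta (\sum_(i <- r) F i) = \sum_(i <- r) contr beta (F i).
Proof. exact/linear_bigsum/contr_linear. Qed.

(** The second factors of [x] are expanded by a finite-rank identity, so that the first factors
    become contractions of [x]. Hence a tensor is determined by its contractions. *)
Lemma tens_contr (V : lmodType K) (x : tens V B) :
  exists T : seq ({scalar B} * B), x = \sum_(q <- T) pure (contr q.1 x) q.2.
Proof.
have [s xs] := tens_pure_sum x; have [pl pr] := pure_bilin V B.
have [T hT] := finite_rank_identity [seq p.2 | p <- s].
exists T; transitivity (\sum_(p <- s) \sum_(q <- T) pure (q.1 p.2 *: p.1) q.2).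
  rewrite {1}xs big_seq [RHS]big_seq; apply: eq_bigr => p ps.
  rewrite {1}[p.2]hT ?map_f // (linear_bigsum _ _ (pr _)).
  by apply: eq_bigr => q _; rewrite (linear_Z _ _ (pr _)) (linear_Z _ _ (pl _)).
rewrite exchange_big /=; apply: eq_bigr => q _.
rewrite xs contr_sum (linear_bigsum _ _ (pl q.2)).
by apply: eq_bigr => p _; rewrite contr_pure.
Qed.

Lemma contr_inj (V : lmodType K) (x y : tens V B) :
  (forall beta, contr beta x = contr beta y) -> x = y.
Proof.
move=> xy; apply/eqP; rewrite -subr_eq0; apply/eqP.
have [T ->] := tens_contr (x - y).
apply: big1 => q _; have -> : contr q.1 (x - y) = 0.
  rewrite [x - y]addrC -scaleN1r (linear_D _ _ (contr_linear _)).
  by rewrite (linear_Z _ _ (contr_linear _)) xy scaleN1r addNr.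
by have [pl _] := pure_bilin V B; rewrite (linear_0 (pl _)).
Qed.

Lemma contr_tmap (V W : lmodType K) (f : V -> W) beta x :
  linear f -> contr beta (tmap f idfun x) = f (contr beta x).
Proof.
move=> fl; have tl := tmap_linear fl (@linear_id _ B).
move: x; apply: tens_ext => [||v b].
- exact: linear_comp tl (contr_linear _).
- exact: linear_comp (contr_linear _) fl.
by rewrite tmap_pure // !contr_pure (linear_Z _ _ fl).
Qed.

Lemma contrDl (V : lmodType K) beta gamma delta (x : tens V B) :
  (forall b, delta b = beta b + gamma b) ->
  contr delta x = contr beta x + contr gamma x.
Proof.
move=> e; move: x; apply: tens_ext => [||v b].
- exact: contr_linear.
- exact: linear_add (contr_linear _) (contr_linear _).
by rewrite !contr_pure e scalerDl.
Qed.

End Contraction.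

(** * Supercomodules as modules over the dual algebra *)

Section Representations.
Variables (K : fieldType) (B : supercoalg K).
Implicit Types (U V W : supercomod B) (beta gamma : {scalar B}).

(** Colinear maps are the linear maps commuting with all the [act beta]
    ([coact_colin], [colin_coact]), and a graded subspace stable under them is a
    subcomodule ([subcomodP]). *)
Definition act V beta (v : V) : V := contr beta (coact v).

Definition colin V W (f : V -> W) : Prop :=
  linear f /\ forall beta v, f (act beta v) = act beta (f v).

(** For [b = true] these are the homomorphisms from [V] to [Pi W], kept as maps into [W] so that
    both parities compose without inserting [Pi]. *)
Definition homog (b : bool) V W (f : V -> W) : Prop :=
  colin f /\ forall i v, f (scomp i v) = scomp (b (+) i) (f v).

Lemma act_linear V beta : linear (@act V beta).
Proof. by move=> a x y; rewrite /act linearP contr_linear. Qed.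

Lemma act_counit V (v : V) : act counit v = v.
Proof. exact: coact1. Qed.

Lemma colin_coact V W (f : V -> W) v :
  colin f -> coact (f v) = tmap f idfun (coact v).
Proof.
move=> [fl fa]; apply: contr_inj => beta.
by rewrite contr_tmap //; exact: esym (fa _ _).
Qed.

Lemma coact_colin V W (f : V -> W) :
  linear f -> (forall v, coact (f v) = tmap f idfun (coact v)) -> colin f.
Proof. by move=> fl fc; split=> // beta v; rewrite /act fc contr_tmap. Qed.

Lemma shom_homog V W (f : shom V W) : homog false f.
Proof.
by split; [apply: coact_colin; [exact: shom_linear|exact: shom_coact]|exact: shom_even].
Qed.

Lemma shom_Pi_homog V W (f : shom V (Pi W)) : @homog true V W f.
Proof.
split; first by apply: (@coact_colin V W); [exact: (shom_linear f)|exact: (shom_coact f)].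
by move=> i v; rewrite (shom_even f).
Qed.

Lemma homog_shom V W (f : V -> W) : homog false f -> exists g : shom V W, forall v, g v = f v.
Proof.
move=> [fc fe]; have fs v := colin_coact v fc; case: fc => fl _.
by exists (Shom fl fe fs).
Qed.

Lemma homog_shom_Pi V W (f : V -> W) :
  homog true f -> exists g : shom V (Pi W), forall v, g v = f v.
Proof.
move=> [fc fe]; have fs v := colin_coact v fc; case: fc => fl _.
by exists (@Shom K B V (Pi W) f fl fe fs).
Qed.

Lemma subcomodP V (P : V -> Prop) :
  P 0 -> (forall a v w, P v -> P w -> P (a *: v + w)) ->
  (forall i v, P v -> P (scomp i v)) ->
  (forall beta v, P v -> P (act beta v)) -> subcomod P.
Proof.
move=> P0 Pl Pc Pa; split=> // v Pv.
have [T vT] := tens_contr (coact v).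
exists [seq (contr q.1 (coact v), q.2) | q <- T]; last by rewrite big_map.
elim: T {vT} => // q T IH p; rewrite inE => /predU1P[->|/IH //].
exact: Pa.
Qed.

Lemma colin_comp U V W (f : U -> V) (g : V -> W) :
  colin f -> colin g -> colin (fun u => g (f u)).
Proof.
move=> [fl fa] [gl ga]; split; first exact: linear_comp.
by move=> beta v; rewrite fa ga.
Qed.

Lemma homog_comp b c U V W (f : U -> V) (g : V -> W) :
  homog b f -> homog c g -> homog (b (+) c) (fun u => g (f u)).
Proof.
move=> [fc fe] [gc ge]; split; first exact: colin_comp fc gc.
by move=> i v; rewrite fe ge addbA (addbC c).
Qed.

Lemma colin0 V W : colin (fun _ : V => 0 : W).
Proof.
split; first by move=> a x y; rewrite scaler0 addr0.
by move=> beta v; rewrite (linear_0 (act_linear _)).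
Qed.

Lemma colin_add V W (f g : V -> W) :
  colin f -> colin g -> colin (fun v => f v + g v).
Proof.
move=> [fl fa] [gl ga]; split; first exact: linear_add.
by move=> beta v; rewrite fa ga (linear_D _ _ (act_linear _)).
Qed.

Lemma colin_scale V W a (f : V -> W) : colin f -> colin (fun v => a *: f v).
Proof.
move=> [fl fa]; split=> [b x y|beta v].
  by rewrite fl scalerDr !scalerA mulrC.
by rewrite fa (linear_Z _ _ (act_linear _)).
Qed.

Lemma colin_sum V W I (r : seq I) (F : I -> V -> W) :
  (forall i, colin (F i)) -> colin (fun v => \sum_(i <- r) F i v).
Proof.
move=> Fc; elim: r => [|i r IH].
  by under eq_fun do rewrite big_nil; exact: colin0.
under eq_fun do rewrite big_cons; exact: colin_add.
Qed.

Fact part_linear (j : bool) beta : scalar (fun b : B => beta (scomp j b)).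
Proof. by move=> a x y; rewrite !linearP. Qed.

Definition part (j : bool) beta : {scalar B} :=
  mk_linear (Z := K^o) (part_linear j beta).

Lemma act_part V beta (v : V) : act beta v = act (part false beta) v + act (part true beta) v.
Proof. by apply: contrDl => b /=; rewrite -linearD scomp_sum. Qed.

(** Contraction by a functional supported in parity [j] keeps only the tensors whose factor in [B]
    has parity [j], so that it shifts the total parity by [j]. *)
Lemma scomp_act_part V i j beta (v : V) :
  scomp i (act (part j beta) v) = act (part j beta) (scomp (i (+) j) v).
Proof.
rewrite /act coact_even; move: (coact v); apply: tens_ext => [||w b].
- by apply: linear_comp (contr_linear _) _ => a x y; rewrite linearP.
- apply: linear_comp (contr_linear _).
  by apply: linear_add; apply: tmap_linear => a x y; rewrite linearP.
rewrite /tcomp !tmap_pure; try by move=> a x y; rewrite linearP.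
rewrite (linear_D _ _ (contr_linear _)) !contr_pure /= !scomp_scomp linearZ /=.
by case: i j => [] []; rewrite /= ?linear0 ?scale0r ?addr0 ?add0r.
Qed.

Lemma scomp_act V i beta (v : V) :
  scomp i (act beta v) = act (part false beta) (scomp i v) +
    act (part true beta) (scomp (~~ i) v).
Proof. by rewrite act_part linearD !scomp_act_part addbF addbT. Qed.

(** The two summands are the diagonal and the off-diagonal blocks of [f] for the gradings. They stay
    colinear because each [act beta] splits into homogeneous parts. *)
Lemma colin_decomp V W (f : V -> W) : colin f ->
  exists f0 f1, [/\ homog false f0, homog true f1 & forall v : V, f v = f0 v + f1 v :> W].
Proof.
move=> [fl fa].
pose g b v := scomp b (f (scomp false v)) + scomp (~~ b) (f (scomp true v)).
have gh b : homog b (g b).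
  split; first split.
  - by apply: linear_add => a x y; rewrite !linearP fl linearP.
  - move=> beta v; rewrite /g !scomp_act !(linear_D _ _ fl) !fa !linearD /=.
    rewrite !scomp_act_part !addbF !addbT negbK addrACA [X in _ + X]addrC.
    by rewrite [RHS]act_part -!(linear_D _ _ (act_linear _)).
  move=> i v; rewrite /g linearD !scomp_scomp.
  by case: b i => [] [] /=; rewrite ?(linear_0 fl) ?linear0 ?addr0 ?add0r.
exists (g false), (g true); split=> // v.
rewrite /g /= addrACA [X in _ + X]addrC !scomp_sum.
by rewrite -(linear_D _ _ fl) scomp_sum.
Qed.

(** The kernel of an odd map is graded as well, so Schur's lemma holds for both parities. *)
Lemma schur_inj b V W (f : V -> W) :
  irreducible V -> homog b f -> (forall v, f v = 0) \/ injective f.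
Proof.
move=> [_ Vi] [[fl fa] fe]; have [|k0|k1] := Vi (fun v => f v = 0).
- apply: subcomodP => [|a v w v0 w0|i v v0|beta v v0].
  + exact: linear_0.
  + by rewrite fl v0 w0 scaler0 addr0.
  + by rewrite fe v0 linear0.
  + by rewrite fa v0 (linear_0 (act_linear _)).
- right=> v w vw; apply/eqP; rewrite -subr_eq0; apply/eqP/k0.
  by rewrite [v - w]addrC -scaleN1r fl vw scaleN1r addNr.
- by left.
Qed.

Lemma schur_surj b V W (f : V -> W) :
  irreducible W -> homog b f -> (forall v, f v = 0) \/ forall w, exists v, f v = w.
Proof.
move=> [_ Wi] [[fl fa] fe]; have [|k0|k1] := Wi (fun w => exists v, f v = w).
- apply: subcomodP => [|a _ _ [v <-] [w <-]|i _ [v <-]|beta _ [v <-]].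
  + by exists 0; exact: linear_0.
  + by exists (a *: v + w); rewrite fl.
  + by exists (scomp (b (+) i) v); rewrite fe addbA addbb.
  + by exists (act beta v).
- by left=> v; apply: k0; exists v.
- by right.
Qed.

Lemma homog_inv b V W (f : V -> W) (g : W -> V) :
  cancel f g -> cancel g f -> homog b f -> homog b g.
Proof.
move=> fK gK [[fl fa] fe]; split; first split.
- by move=> a x y; apply: (can_inj fK); rewrite fl !gK.
- by move=> beta v; apply: (can_inj fK); rewrite fa !gK.
- by move=> i v; apply: (can_inj fK); rewrite fe !gK addbA addbb.
Qed.

Fact conv_linear beta gamma : scalar (fun b : B => beta (contr gamma (comul b))).
Proof. by move=> a x y; rewrite linearP contr_linear linearP. Qed.

(** The convolution product of the dual algebra, in the order that makes [act] a left action. *)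
Definition conv beta gamma : {scalar B} :=
  mk_linear (Z := K^o) (conv_linear beta gamma).

(** By coassociativity both sides contract the last two factors of the iterated coaction with [m],
    the tensor product of [beta] and [gamma]. *)
Lemma act_act V beta gamma (v : V) :
  act beta (act gamma v) = act (conv beta gamma) v.
Proof.
have [pl pr] := pure_bilin B B.
pose m (t : tens B B) : K^o := beta (contr gamma t).
have ml : linear m.
  by apply: linear_comp (contr_linear gamma) _ => a x y; rewrite linearP.
pose h := mk_linear ml.
have hb := @scale_bilinr K V (tens B B) h.
have hl := tlift_linear hb.
have cl : linear (tmap (@coact K B V) (@idfun B)).
  by apply: tmap_linear => // a x y; rewrite linearP.
have dl : linear (tmap (@idfun V) (@comul K B)).
  by apply: tmap_linear => // a x y; rewrite linearP.
transitivity (tlift (fun v t => h t *: v) (tmap idfun comul (coact v))); last first.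
  rewrite /act; move: (coact v); apply: tens_ext => [||w b].
  - exact: linear_comp dl hl.
  - exact: contr_linear.
  by rewrite tmap_pure ?tlift_pure ?contr_pure // => a x y; rewrite linearP.
rewrite -coactA /act; move: (coact v); apply: tens_ext => [||w b].
- by move=> a x y; rewrite contr_linear linearP contr_linear.
- exact: linear_comp (linear_comp cl (@tassoc_linear _ _ _ _)) hl.
rewrite contr_pure tmap_pure //; last by move=> a x y; rewrite linearP.
rewrite linearZ (linear_Z _ _ (contr_linear _)) /=.
have [ql _] := pure_bilin (tens V B) B.
move: (coact w); apply: tens_ext => [||u c].
- by move=> a x y; rewrite contr_linear scalerDr !scalerA mulrC.
- exact: linear_comp (linear_comp (ql b) (@tassoc_linear _ _ _ _)) hl.
rewrite tassoc_pure tlift_pure // contr_pure /= /m contr_pure linearZ /=.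
by rewrite scalerA [beta (_ *: _)]linearZ /= mulrC.
Qed.

Fact comb_linear a beta gamma : scalar (fun b : B => a * beta b + gamma b).
Proof. by move=> c x y; rewrite !linearP mulrDr mulrCA addrACA -mulrDr. Qed.

Definition comb a beta gamma : {scalar B} :=
  mk_linear (Z := K^o) (comb_linear a beta gamma).

Lemma act_comb V a beta gamma (v : V) :
  act (comb a beta gamma) v = a *: act beta v + act gamma v.
Proof.
rewrite /act; move: (coact v); apply: tens_ext => [||w b].
- exact: contr_linear.
- move=> c x y; rewrite !contr_linear !scalerDr !scalerA addrACA.
  by rewrite (mulrC a).
by rewrite !contr_pure /= scalerDl scalerA.
Qed.

Lemma homogeneous_neq0 V (v : V) : v != 0 -> exists i, scomp i v != 0.
Proof.
move=> v0; have [e0|] := eqVneq (scomp false v) 0; last by exists false.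
by exists true; apply: contra v0 => /eqP e1; rewrite -[v]scomp_sum e0 e1 addr0.
Qed.

(** The vectors [act beta w], for w homogeneous, form a subcomodule, which is
    spanned by the finitely many coefficients of [coact w]. *)
Lemma irreducible_fin_dim V : irreducible V ->
  exists n (mu : 'I_n -> {scalar V}) (e : 'I_n -> V),
    forall v, v = \sum_(i < n) mu i v *: e i.
Proof.
move=> [[v v0] Vi]; have [i w0] := homogeneous_neq0 v0; set w := scomp i v in w0.
have wi j : scomp j w = if j == i then w else 0.
  by rewrite scomp_scomp.
have [|k0|k1] := Vi (fun u => exists beta, u = act beta w).
- apply: subcomodP => [|a _ _ [beta ->] [gamma ->]|j _ [beta ->]|gamma _ [beta ->]].
  + exists (comb (-1) counit counit).
    by rewrite act_comb scaleN1r addNr.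
  + by exists (comb a beta gamma); rewrite act_comb.
  (* As [w] has parity [i], the component of parity [j] comes from the part of [beta] of parity
     [j (+) i]. *)
  + exists (part (j (+) i) beta); rewrite scomp_act !wi.
    by case: (j) (i) => [] [] /=; rewrite (linear_0 (act_linear _)) ?addr0 ?add0r.
  + by exists (conv gamma beta); rewrite act_act.
- by case/eqP: w0; apply: k0; exists counit; rewrite act_counit.
have [s ws] := tens_pure_sum (coact w).
have [T hT] := finite_rank_identity [seq p.1 | p <- s].
exists (size T), (fun i => (tnth (in_tuple T) i).1), (fun i => (tnth (in_tuple T) i).2) => u.
rewrite -(big_tnth _ _ _ xpredT (fun q : {scalar V} * V => q.1 u *: q.2)).
have [beta ->] := k1 u.
rewrite /act ws contr_sum.
transitivity (\sum_(p <- s) \sum_(q <- T) q.1 (beta p.2 *: p.1) *: q.2).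
  rewrite big_seq [RHS]big_seq; apply: eq_bigr => p ps.
  rewrite contr_pure {1}(hT _ (map_f _ ps)) scaler_sumr.
  by apply: eq_bigr => q _; rewrite [q.1 (_ *: _)]linearZ /= scalerA.
rewrite exchange_big; apply: eq_bigr => q _.
rewrite -scaler_suml linear_sum; congr (_ *: _).
by apply: eq_bigr => p _; rewrite contr_pure.
Qed.

End Representations.

(** * The Galois group of the separable closure *)

Section GaloisFixed.
Variables (F L : fieldType) (iota : {rmorphism F -> L}).
Hypothesis L_sep : is_separable_closure iota.
Implicit Types (Gm : L * L -> Prop) (P Q : {poly L}).

(** The graph of an F-homomorphism from an F-subalgebra of L to L.  Such a map is
    injective, L being algebraic, so that the notion is symmetric: a maximal graph
    is the graph of an automorphism. *)
Definition hom_graph Gm : Prop :=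
  [/\ forall c, Gm (iota c, iota c),
      forall a b a' b', Gm (a, b) -> Gm (a', b') -> Gm (a - a', b - b'),
      forall a b a' b', Gm (a, b) -> Gm (a', b') -> Gm (a * a', b * b') &
      forall b, Gm (0, b) -> b = 0].

Definition graph_poly Gm P Q : Prop := forall i, Gm (P`_i, Q`_i).

Section Graph.
Variables (Gm : L * L -> Prop) (Gm_hom : hom_graph Gm).

Lemma graph0 : Gm (0, 0).
Proof. by have [/(_ 0) + _ _ _] := Gm_hom; rewrite rmorph0. Qed.

Lemma graph1 : Gm (1, 1).
Proof. by have [/(_ 1) + _ _ _] := Gm_hom; rewrite rmorph1. Qed.

Lemma graphB a b a' b' : Gm (a, b) -> Gm (a', b') -> Gm (a - a', b - b').
Proof. by have [_ + _ _] := Gm_hom; apply. Qed.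

Lemma graphM a b a' b' : Gm (a, b) -> Gm (a', b') -> Gm (a * a', b * b').
Proof. by have [_ _ + _] := Gm_hom; apply. Qed.

Lemma graphD a b a' b' : Gm (a, b) -> Gm (a', b') -> Gm (a + a', b + b').
Proof.
move=> h h'; rewrite -[a']opprK -[b']opprK; apply: graphB => //.
by rewrite -[- a']sub0r -[- b']sub0r; apply: graphB => //; exact: graph0.
Qed.

Lemma graph_sum I (r : seq I) (A B : I -> L) :
  (forall i, Gm (A i, B i)) -> Gm (\sum_(i <- r) A i, \sum_(i <- r) B i).
Proof.
move=> h; elim: r => [|i r IH]; first by rewrite !big_nil; exact: graph0.
by rewrite !big_cons; exact: graphD.
Qed.

Lemma graph_poly_sub P Q P' Q' : graph_poly Gm P Q -> graph_poly Gm P' Q' ->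
  graph_poly Gm (P - P') (Q - Q').
Proof. by move=> h h' i; rewrite !coefB; exact: graphB. Qed.

Lemma graph_poly_mul P Q P' Q' : graph_poly Gm P Q -> graph_poly Gm P' Q' ->
  graph_poly Gm (P * P') (Q * Q').
Proof. by move=> h h' i; rewrite !coefM; apply: graph_sum => j; exact: graphM. Qed.

Lemma graph_polyC a b : Gm (a, b) -> graph_poly Gm a%:P b%:P.
Proof. by move=> h i; rewrite !coefC; case: ifP => // _; exact: graph0. Qed.

Lemma graph_polyXn n : graph_poly Gm 'X^n 'X^n.
Proof. by move=> i; rewrite !coefXn; case: eqP => _; [exact: graph1|exact: graph0]. Qed.

Lemma graph_poly_map (q : {poly F}) : graph_poly Gm (map_poly iota q) (map_poly iota q).
Proof. by move=> i; rewrite !coef_map; have [h _ _ _] := Gm_hom; exact: h. Qed.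

Lemma graph_poly_horner P Q a b :
  graph_poly Gm P Q -> Gm (a, b) -> Gm (P.[a], Q.[b]).
Proof.
move=> h hab; have hX n : Gm (a ^+ n, b ^+ n).
  by elim: n => [|n IH]; [exact: graph1|rewrite !exprS; exact: graphM].
have := @graph_sum _ (index_iota 0 (maxn (size P) (size Q)))
  (fun i => P`_i * a ^+ i) (fun i => Q`_i * b ^+ i) (fun i => graphM (h i) (hX i)).
rewrite (@horner_coef_wide _ (maxn (size P) (size Q))) ?leq_maxl //.
by rewrite (@horner_coef_wide _ (maxn (size P) (size Q)) Q) ?leq_maxr // !big_mkord.
Qed.

(** If [a] is nonzero, it is a root of a polynomial [r] over F with nonzero constant term, obtained
    by removing the powers of X from a polynomial that kills [a]. Applying the partial homomorphism
    shows that [r] vanishes at 0, a contradiction. *)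
Lemma graph_inj a : Gm (a, 0) -> a = 0.
Proof.
move=> ha; apply/eqP/negP => /negP a0.
have [q qs qa] := L_sep.1 a.
have q0 : q != 0 by apply: separable_poly_neq0.
have [m [r r0 qE]] := multiplicity_XsubC q 0.
have ra : root (map_poly iota r) a.
  move: qa; rewrite qE subr0 rmorphM rmorphXn /= map_polyX rootM.
  case/orP => // /rootP; rewrite hornerXn => /eqP; rewrite expf_eq0.
  by rewrite (negbTE a0) andbF.
have /= := graph_poly_horner (graph_poly_map r) ha.
rewrite (rootP ra) => h0.
have {h0} : (map_poly iota r).[0] = 0 by case: Gm_hom => _ _ _; apply.
rewrite horner_coef0 coef_map /= -horner_coef0 => /eqP; rewrite fmorph_eq0 => r00.
by move: r0; rewrite q0 /= => /negP; apply; apply/rootP/eqP.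
Qed.

Lemma graph_fun b : Gm (0, b) -> b = 0.
Proof. by case: Gm_hom => _ _ _; apply. Qed.

Lemma graph_poly_size P Q : graph_poly Gm P Q -> size P = size Q.
Proof.
move=> h; apply/eqP; rewrite eqn_leq; apply/andP; split; apply/leq_sizeP => i hi.
  by apply: graph_inj; have := h i; rewrite [Q`_i]nth_default.
by apply: graph_fun; have := h i; rewrite [P`_i]nth_default.
Qed.

Lemma graph_poly0 Q : graph_poly Gm 0 Q -> Q = 0.
Proof.
move/graph_poly_size/esym; rewrite size_poly0 => /eqP.
by rewrite size_poly_eq0 => /eqP.
Qed.

(** Pseudo-division run on both sides at once. The domain of [Gm] is only a subring, so each step
    multiplies by the leading coefficient instead of dividing by it. *)
Lemma graph_pdiv M N P Q : graph_poly Gm M N -> M != 0 -> graph_poly Gm P Q ->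
  exists a b A B S T, [/\ a != 0, b != 0,
    graph_poly Gm S T /\ (size S < size M)%N,
    a *: P = A * M + S & b *: Q = B * N + T].
Proof.
move=> MN M0; have szMN := graph_poly_size MN.
have lc : Gm (lead_coef M, lead_coef N).
  by rewrite !lead_coefE -szMN; exact: MN.
have lM0 : lead_coef M != 0 by rewrite lead_coef_eq0.
have lN0 : lead_coef N != 0.
  by apply: contra lM0 => /eqP h; apply/eqP/graph_inj; rewrite -h.
have [n] := ubnP (size P); elim: n P Q => // n IH P Q /ltnSE szP PQ.
have [ltPM|leMP] := ltnP (size P) (size M).
  by exists 1, 1, 0, 0, P, Q; split; rewrite ?oner_eq0 // ?scale1r ?mul0r ?add0r.
have szPQ := graph_poly_size PQ.
pose k := (size P - size M)%N.
pose U := (lead_coef P)%:P * 'X^k; pose V := (lead_coef Q)%:P * 'X^k.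
have UV : graph_poly Gm U V.
  apply: graph_poly_mul (graph_polyXn k); apply: graph_polyC.
  by rewrite !lead_coefE -szPQ; exact: PQ.
pose P1 := (lead_coef M)%:P * P - U * M; pose Q1 := (lead_coef N)%:P * Q - V * N.
have PQ1 : graph_poly Gm P1 Q1.
  apply: graph_poly_sub; apply: graph_poly_mul => //; exact: graph_polyC.
have P0 : P != 0.
  by rewrite -size_poly_gt0; apply: leq_trans leMP; rewrite size_poly_gt0.
have lt1 : (size P1 < size P)%N.
  have sP : (0 < size P)%N by rewrite size_poly_gt0.
  rewrite -(prednK sP) ltnS; apply/leq_sizeP => j hj.
  rewrite coefB coefCM /U -mulrA coefCM coefXnM.
  have [lt|] := ltnP j k.
    by move: lt; rewrite ltnNge (leq_trans _ hj) // /k -subn1 leq_sub2l // size_poly_gt0.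
  move=> kj; have [->|ne] := eqVneq j (size P).-1.
    have -> : ((size P).-1 - k)%N = (size M).-1.
      rewrite /k -!subn1 subnAC subKn //.
    by rewrite -!lead_coefE mulrC subrr.
  have gt : (size P <= j)%N by rewrite -(prednK sP) ltn_neqAle eq_sym ne.
  rewrite [P`_j]nth_default // [M`_(j - k)]nth_default ?mulr0 ?subr0 //.
  by rewrite leq_subRL // /k subnK.
have [a [b [A [B [S [T [a0 b0 ST aE bE]]]]]]] := IH P1 Q1 (leq_trans lt1 szP) PQ1.
exists (a * lead_coef M), (b * lead_coef N), (A + a *: U), (B + b *: V), S, T.
split=> //; rewrite ?mulf_neq0 //.
  rewrite -scalerA -[lead_coef M *: P]mul_polyC -[X in a *: X](subrK (U * M)).
  rewrite -/P1 scalerDr aE.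
  by rewrite mulrDl -scalerAl addrAC.
rewrite -scalerA -[lead_coef N *: Q]mul_polyC -[X in b *: X](subrK (V * N)).
rewrite -/Q1 scalerDr bE.
by rewrite mulrDl -scalerAl addrAC.
Qed.

(** The pair [(M, N)] plays the role of the minimal polynomial of [y] over the
    domain of the partial homomorphism, and of its image. *)
Lemma graph_extend y : exists M N, [/\ graph_poly Gm M N, root M y,
  separable_poly N, (1 < size N)%N & forall y', root N y' ->
  exists Gm', [/\ hom_graph Gm', forall z, Gm z -> Gm' z & Gm' (y, y')]].
Proof.
have [q qs qy] := L_sep.1 y; set q' := map_poly iota q in qy.
have q's : separable_poly q' by rewrite separable_map.
have q'0 : q' != 0 by apply: separable_poly_neq0.
(* The sizes of the nonzero polynomials over the domain of [Gm] that kill [y]; [M] is chosen of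
   minimal size. *)
pose annih n := `[< exists P Q, [/\ graph_poly Gm P Q, P != 0, root P y & size P = n] >].
have exn : exists n, annih n.
  by exists (size q'); apply/asboolP; exists q', q'; split=> //; exact: graph_poly_map.
case: (ex_minnP exn) => n /asboolP[M [N [MN M0 My szM]]] nmin.
(* The remainder of [P] by [M] kills [y] and is shorter than [M], so it is 0. Its partner [T] is
   then 0 too, and [N] divides a nonzero multiple of [Q]. *)
have redu P Q : graph_poly Gm P Q -> root P y -> exists2 b, b != 0 & N %| b *: Q.
  move=> PQ Py; have [a [b [A [B [S [T [a0 b0 [ST ltS] aE bE]]]]]]] := graph_pdiv MN M0 PQ.
  exists b => //; rewrite bE.
  have S0 : S = 0.
    apply/eqP; apply: contraT => S0; move: ltS; rewrite ltnNge szM nmin //.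
    apply/asboolP; exists S, T; split=> //; apply/rootP.
    have -> : S = a *: P - A * M by rewrite aE addrC addKr.
    by rewrite !hornerE (rootP Py) (rootP My) !mulr0 subr0.
  have -> : T = 0 by apply: graph_poly0; rewrite -S0.
  by rewrite addr0 dvdp_mulIr.
have Nq : N %| q'.
  have [b b0] := redu _ _ (graph_poly_map q) qy.
  by rewrite dvdpZr.
exists M, N; split=> //.
- exact: dvdp_separable q's.
- rewrite -(graph_poly_size MN); have [//|le1] := ltnP 1%N (size M).
  have := size1_polyC le1; move: (M`_0) => m MC.
  by move: My M0; rewrite MC rootC polyC_eq0 => ->.
move=> y' Ny'.
(* The extension sends [P.[y]] to [Q.[y']]. By [redu], [P.[y] = 0] forces [Q.[y'] = 0]. *)
exists (fun z => exists P Q, graph_poly Gm P Q /\ z = (P.[y], Q.[y'])).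
split; first split.
- move=> c; exists (iota c)%:P, (iota c)%:P; rewrite !hornerC; split=> //.
  by apply: graph_polyC; have [h _ _ _] := Gm_hom; exact: h.
- move=> _ _ _ _ [P [Q [PQ [-> ->]]]] [P' [Q' [PQ' [-> ->]]]].
  by exists (P - P'), (Q - Q'); rewrite !hornerE; split=> //; exact: graph_poly_sub.
- move=> _ _ _ _ [P [Q [PQ [-> ->]]]] [P' [Q' [PQ' [-> ->]]]].
  by exists (P * P'), (Q * Q'); rewrite !hornerE; split=> //; exact: graph_poly_mul.
- move=> _ [P [Q [PQ [Py ->]]]]; have [|b b0] := redu _ _ PQ; first exact/rootP.
  by rewrite dvdpZr // => /dvdpP[C ->]; rewrite hornerM (rootP Ny') mulr0.
- move=> [a b] ab; exists a%:P, b%:P; rewrite !hornerC; split=> //.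
  exact: graph_polyC.
- by exists 'X^1, 'X^1; rewrite !hornerXn; split=> //; exact: graph_polyXn.
Qed.

Lemma graph_swap : hom_graph (fun z => Gm (z.2, z.1)).
Proof.
case: (Gm_hom) => h1 h2 h3 _; split=> /= [//|a b a' b'|a b a' b'|b].
- by move=> ? ?; apply: h2.
- by move=> ? ?; apply: h3.
- exact: graph_inj.
Qed.

End Graph.

Lemma graph_total Gm : hom_graph Gm -> 
  (forall Gm', hom_graph Gm' -> (forall z, Gm z -> Gm' z) -> forall z, Gm' z -> Gm z) ->
  forall y, exists y', Gm (y, y').
Proof.
move=> Gh Gmax y; have [M [N [_ _ Ns N1 ext]]] := graph_extend Gh y.
have [y' Ny'] := L_sep.2 N Ns N1; exists y'.
by have [Gm' [Gh' sub]] := ext _ Ny'; exact: Gmax.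
Qed.

(** If [x] is not in F, its separable minimal polynomial has another root [x']. The homomorphism
    that sends [x] to [x'] extends by Zorn to a maximal graph, which is the graph of an automorphism
    moving [x]. *)
Lemma galois_fixed x : (forall s : absgal iota, s x = x) -> exists a, x = iota a.
Proof.
move=> fix_x; apply: contrapT => nx.
pose G0 z := exists c, z = (iota c, iota c).
have G0h : hom_graph G0.
  split=> [c|_ _ _ _ [c [-> ->]] [d [-> ->]]|_ _ _ _ [c [-> ->]] [d [-> ->]]|b].
  - by exists c.
  - by exists (c - d); rewrite !rmorphB.
  - by exists (c * d); rewrite !rmorphM.
  - by move=> [c [/esym/eqP + ->]] => /eqP.
have [M [N [MN Mx Ns N1 ext]]] := graph_extend G0h x.
have MN' : M = N by apply/polyP => i; have [c [-> ->]] := MN i.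
have [R NR] : exists R, N = R * ('X - x%:P) by apply/factor_theorem; rewrite -MN'.
(* Otherwise [N] is linear with coefficients from F, and its root [x] lies in F. *)
have R1 : (1 < size R)%N.
  rewrite ltnNge; apply/negP => le1; apply: nx.
  have := size1_polyC le1; move: (R`_0) => r Rr; rewrite {}Rr in NR.
  have r0 : r != 0 by apply: contraTneq N1; rewrite NR => ->; rewrite mul0r size_poly0.
  have [c [cE _]] := MN 1%N; have [d [dE _]] := MN 0%N.
  move: cE dE; rewrite MN' NR !coefCM !coefB !coefX !coefC /= subr0 mulr1 sub0r.
  move=> rc rd; exists (- d / c); rewrite rmorphM rmorphN fmorphV /= -rc -rd.
  by rewrite mulrN opprK mulrC mulKf.
have [x' Rx'] : exists x', root R x'.
  by apply: L_sep.2 R1; apply: dvdp_separable Ns; rewrite NR dvdp_mulIl.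
have xx' : x' != x.
  apply/eqP => e; move: Ns; rewrite NR separable_mul => /and3P[_ _].
  by rewrite coprimep_XsubC -e Rx'.
have [G1 [G1h _ G1x]] : exists G1, [/\ hom_graph G1, forall z, G0 z -> G1 z & G1 (x, x')].
  by apply: ext; rewrite NR rootM Rx'.
have [|G [Gh G1G Gmax]] := @zorn_predicate _ hom_graph G1 G1h.
  move=> C [A CA] Cg Cc; split=>
    [c|a b a' b' [D CD Dz] [E CE Ez]|a b a' b' [D CD Dz] [E CE Ez]|b [D CD Dz]].
  - by exists A => //; case: (Cg _ CA).
  - have [DE|ED] := Cc _ _ CD CE.
      by exists E => //; exact (graphB (Cg _ CE) (DE _ Dz) Ez).
    by exists D => //; exact (graphB (Cg _ CD) Dz (ED _ Ez)).
  - have [DE|ED] := Cc _ _ CD CE.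
      by exists E => //; exact (graphM (Cg _ CE) (DE _ Dz) Ez).
    by exists D => //; exact (graphM (Cg _ CD) Dz (ED _ Ez)).
  - exact (graph_fun (Cg _ CD) Dz).
have [s sP] := choice (graph_total Gh Gmax).
(* The transposed graph is maximal too, so every [y] is also a value; this gives the inverse of
   [s]. *)
have /choice[t tP] y : exists a, G (a, y).
  have [||y' ?] := @graph_total (fun z => G (z.2, z.1)) _ _ y; last by exists y'.
    exact: graph_swap.
  move=> Gm' /graph_swap Gh' sub [a b] /= hab.
  by apply: (Gmax _ Gh') => // -[u v] /= Guv; exact: sub.
have Gu a b b' : G (a, b) -> G (a, b') -> b = b'.
  move=> h h'; apply/eqP; rewrite -subr_eq0; apply/eqP/(graph_fun Gh).
  by rewrite -(subrr a); exact: graphB.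
have Gi a a' b : G (a, b) -> G (a', b) -> a = a'.
  move=> h h'; apply/eqP; rewrite -subr_eq0; apply/eqP/(graph_inj Gh).
  by rewrite -(subrr b); exact: graphB.
have sB : zmod_morphism s by move=> a b; apply: Gu (sP _) _; exact: graphB.
have sM : monoid_morphism s.
  split; first by apply: Gu (sP _) _; exact: graph1.
  by move=> a b; apply: Gu (sP _) _; exact: graphM.
pose s' : {rmorphism L -> L} :=
  HB.pack s (GRing.isZmodMorphism.Build L L s sB) (GRing.isMonoidMorphism.Build L L s sM).
have s_bij : bijective s'.
  exists t => y; first by apply: (Gi _ _ (s y)) => //.
  by apply: (Gu (t y)) => //; exact: sP.
have s_fix a : s' (iota a) = iota a.
  by apply: Gu (sP _) _; have [h _ _ _] := Gh; exact: h.
have /= sx := fix_x (AbsGal s_bij s_fix).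
by case/eqP: xx'; rewrite -[RHS]sx; apply: Gu (G1G _ G1x) (sP x).
Qed.

End GaloisFixed.

(** * Extension of scalars *)

Section ExtTheory.
Variables (F L : fieldType) (iota : {rmorphism F -> L}).
Implicit Types U : lmodType F.

Local Notation ein := (ext_in iota).

Lemma ext_inZ U c (u : U) : ein (c *: u) = iota c *: ein u.
Proof. by have := ext_in_semilinear iota c u 0; rewrite !addr0 ext_in0 addr0. Qed.

Lemma ext_in_sum U I (r : seq I) (f : I -> U) :
  ein (\sum_(i <- r) f i) = \sum_(i <- r) ein (f i).
Proof.
elim: r => [|i r IH]; first by rewrite !big_nil ext_in0.
by rewrite !big_cons ext_inD IH.
Qed.

Lemma ext_sum U (x : ext iota U) :
  exists s : seq (L * U), x = \sum_(p <- s) p.1 *: ein p.2.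
Proof. by exists (univ_repr x); exact: univ_sum. Qed.

(** The test on all [a *: ein u] serves for maps such as [ext_contr lambda], which are linear over F
    only. *)
Lemma ext_additive_ext U (Z : zmodType) (f g : ext iota U -> Z) :
  (forall x y, f (x + y) = f x + f y) -> (forall x y, g (x + y) = g x + g y) ->
  (forall a u, f (a *: ein u) = g (a *: ein u)) -> forall x, f x = g x.
Proof.
move=> fD gD fg x; have [s ->] := ext_sum x.
have z (h : ext iota U -> Z) : (forall x y, h (x + y) = h x + h y) -> h 0 = 0.
  by move=> hD; apply: (addrI (h 0)); rewrite -hD !addr0.
elim: s => [|p s IH]; first by rewrite !big_nil !z.
by rewrite !big_cons fD gD fg IH.
Qed.

Section Scalar.
Variables (U : lmodType F) (mu : {scalar U}).

Fact ext_scalar_semilinear : @Defs.semilinear F L iota U L^o (fun u => iota (mu u)).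
Proof. by move=> a x y; rewrite linearP rmorphD rmorphM. Qed.

Definition ext_scalar : {scalar ext iota U} :=
  mk_linear (Z := L^o) (ext_lift_linear ext_scalar_semilinear).

Lemma ext_scalar_in u : ext_scalar (ein u) = iota (mu u).
Proof. exact: (ext_lift_in _ ext_scalar_semilinear). Qed.

End Scalar.

Definition ext_map U U' (f : U -> U') : ext iota U -> ext iota U' :=
  ext_lift (fun u => ein (f u)).

Section Map.
Variables (U U' : lmodType F) (f : U -> U').
Hypothesis f_lin : linear f.

Fact ext_map_semilinear : Defs.semilinear iota (fun u => ein (f u)).
Proof. by move=> a x y; rewrite f_lin ext_in_semilinear. Qed.

Lemma ext_map_linear : linear (ext_map f).
Proof. exact: ext_lift_linear ext_map_semilinear. Qed.

Lemma ext_map_in u : ext_map f (ein u) = ein (f u).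
Proof. exact: ext_lift_in ext_map_semilinear. Qed.

End Map.

Section GaloisAction.
Variables (s : absgal iota) (U : lmodType F).

Definition gal_ext : ext iota U -> ext iota U :=
  @ext_lift F L iota U (restr s (ext iota U)) (@ext_in F L iota U).

Fact gal_ext_in_semilinear :
  @Defs.semilinear F L iota U (restr s (ext iota U)) (@ext_in F L iota U).
Proof. by move=> a x y; rewrite ext_in_semilinear -[in LHS](gal_fix s). Qed.

Lemma gal_ext_in u : gal_ext (ein u) = ein u.
Proof. exact: (ext_lift_in _ gal_ext_in_semilinear). Qed.

Lemma gal_ext_semilinear : Defs.semilinear s gal_ext.
Proof. exact: (ext_lift_linear gal_ext_in_semilinear). Qed.

End GaloisAction.

Lemma gal_ext_even s (U : superspace F) i (x : ext_space iota U) :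
  gal_ext s (scomp i x) = scomp i (gal_ext s x : ext_space iota U).
Proof.
have gl := @gal_ext_semilinear s U.
move: x; apply: (@ext_semi_ext F L iota s) => [||u].
- by apply: comp_semilinear gl => c x y; rewrite linearP.
- by apply: semilinear_comp gl _ => c x y; rewrite linearP.
have e : scomp i (ein u : ext_space iota U) = ein (scomp i u) := ext_comp_in iota i u.
by rewrite e !gal_ext_in e.
Qed.

(** Galois descent for vectors: an element of [S] of minimal length, with a
    coefficient normalised to 1, is Galois invariant. *)
Lemma galois_descent (L_sep : is_separable_closure iota) U (S : ext iota U -> Prop) :
  (forall a x y, S x -> S y -> S (a *: x + y)) ->
  (forall s x, S x -> S (gal_ext s x)) ->
  (exists2 x, S x & x != 0) -> exists2 u, u != 0 & S (ein u).
Proof.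
move=> Sl Sg [x Sx x0].
have SZ a y : S y -> S (a *: y).
  move=> Sy; have S0 : S 0 by have := Sl (-1) _ _ Sy Sy; rewrite scaleN1r addNr.
  by have := Sl a _ _ Sy S0; rewrite addr0.
pose sm (r : seq (L * U)) := \sum_(p <- r) p.1 *: ein p.2.
pose len n := `[< exists r, [/\ S (sm r), sm r != 0 & size r = n] >].
have ex_len : exists n, len n.
  have [r xr] := ext_sum x; exists (size r); apply/asboolP; exists r.
  by rewrite /sm -xr.
case: (ex_minnP ex_len) => n /asboolP[r [Sr r0 rn]] nmin.
have short r' : S (sm r') -> (size r' < n)%N -> sm r' = 0.
  move=> Sr' lt; apply/eqP; apply: contraLR lt => r'0.
  by rewrite -leqNgt nmin //; apply/asboolP; exists r'.
case: r Sr r0 rn => [_|[c v] r]; first by rewrite /sm big_nil eqxx.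
have smZ a r' : a *: sm r' = sm [seq (a * p.1, p.2) | p <- r'].
  by rewrite /sm big_map scaler_sumr; apply: eq_bigr => p _; rewrite scalerA.
have smc p r' : sm (p :: r') = p.1 *: ein p.2 + sm r' by rewrite /sm big_cons.
move=> Sr r0 rn.
have c0 : c != 0.
  apply: contraNneq r0 => c0; move: Sr; rewrite smc c0 scale0r add0r => Sr.
  by rewrite short // -rn.
pose r1 := [seq (c^-1 * p.1, p.2) | p <- r].
have w_eq : c^-1 *: sm ((c, v) :: r) = ein v + sm r1.
  by rewrite smc scalerDr scalerA mulVf // scale1r smZ.
have Sw : S (ein v + sm r1) by rewrite -w_eq; exact: SZ.
have w0 : ein v + sm r1 != 0 by rewrite -w_eq scaler_eq0 invr_eq0 negb_or c0.
have r1n : (size r1).+1 = n by rewrite size_map.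
clearbody r1; clear w_eq Sr r0 rn c c0 r.
(* Either all coefficients of [r1] lie in F and the vector is of the form [ein _], or some
   coefficient [c] is moved by some [s], which will yield a shorter expression of the same
   vector. *)
have [rat|/allPn[[c u] r1u /asboolP /= irr]] :=
    boolP (all (fun p : L * U => `[< exists a, p.1 = iota a >]) r1).
  have [u' uE] : exists u', sm r1 = ein u'.
    elim: (r1) rat => [|p q IH]; first by exists 0; rewrite /sm big_nil ext_in0.
    rewrite /= => /andP[/asboolP[a pa] /IH[u' qu]].
    by exists (a *: p.2 + u'); rewrite smc qu ext_inD ext_inZ pa.
  exists (v + u'); last by rewrite ext_inD -uE.
  by apply: contraNneq w0; rewrite uE -ext_inD => ->; rewrite ext_in0.
have [s sc] : exists s : absgal iota, s c != c.
  apply: contrapT => ns; apply/irr/(galois_fixed L_sep) => s.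
  by apply/eqP; apply: contrapT => sc; apply: ns; exists s; apply/negP.
pose r2 := [seq (s p.1 - p.1, p.2) | p <- r1].
have [gD gZ] : (forall y z, gal_ext s (y + z) = gal_ext s y + gal_ext s z :> ext iota U)
    /\ (forall a y, gal_ext s (a *: y) = s a *: gal_ext s y :> ext iota U).
  have gl := @gal_ext_semilinear s U.
  have g0 : gal_ext s 0 = 0 :> ext iota U.
    by rewrite -(ext_in0 iota U) gal_ext_in.
  split=> [y z|a y]; first by have := gl 1 y z; rewrite rmorph1 !scale1r.
  by have := gl a y 0; rewrite g0 !addr0.
(* The term [ein v] has coefficient 1 and cancels in the difference, which thus has the length of
   [r1] and must vanish by minimality. *)
have r2E : gal_ext s (ein v + sm r1) - (ein v + sm r1) = sm r2.
  rewrite gD gal_ext_in opprD addrACA subrr add0r /sm big_map.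
  elim: (r1) => [|p q IH]; first by rewrite !big_nil -(ext_in0 iota U) gal_ext_in subrr ext_in0.
  rewrite !big_cons gD gZ gal_ext_in opprD addrACA IH.
  by rewrite scalerBl.
have r20 : sm r2 = 0.
  apply: short; last by rewrite size_map -r1n.
  by rewrite -r2E addrC -scaleN1r; apply: Sl => //; exact: Sg.
pose q := rem (c, u) r1.
have r1q : perm_eq r1 ((c, u) :: q) by exact: perm_to_rem.
have r2q : (s c - c) *: ein u + sm [seq (s p.1 - p.1, p.2) | p <- q] = 0.
  by rewrite -[LHS](smc (s c - c, u)) -r20; apply: perm_big; rewrite perm_sym (perm_map _ r1q).
have d0 : s c - c != 0 by rewrite subr_eq0.
(* As [s c - c] is invertible, the relation [sm r2 = 0] expresses [ein u] by the remaining vectors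
   of [r1]; substituting it shortens the vector. *)
have uE : ein u = sm [seq (- (s c - c)^-1 * (s p.1 - p.1), p.2) | p <- q].
  transitivity (- (s c - c)^-1 *: sm [seq (s p.1 - p.1, p.2) | p <- q]).
    move/eqP: r2q; rewrite addr_eq0 => /eqP/(congr1 (fun z => (s c - c)^-1 *: z)).
    by rewrite scalerA mulVf // scale1r scalerN scaleNr.
  by rewrite smZ -map_comp.
case/negP: w0; apply/eqP.
pose q' := [seq (c * (- (s c - c)^-1 * (s p.1 - p.1)) + p.1, p.2) | p <- q].
have wE : ein v + sm r1 = sm ((1, v) :: q').
  rewrite smc scale1r; congr (_ + _).
  transitivity (c *: ein u + sm q); first by rewrite -(smc (c, u)); exact: perm_big.
  rewrite uE smZ /sm !big_map -big_split /=; apply: eq_bigr => p _.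
  by rewrite -scalerDl.
rewrite wE; apply: short; first by rewrite -wE.
by rewrite /= size_map -r1n ltnS (perm_size r1q).
Qed.

End ExtTheory.

(** * Isotypic decomposition *)

Section Frames.
Variables (K : fieldType) (B : supercoalg K) (V W : supercomod B).
Hypothesis V_irr : irreducible V.

(** The isotypic part of [W] for [V] and [Pi V] together. *)
Inductive hspan : W -> Prop :=
| hspan0 : hspan 0
| hspan_add b (g : V -> W) v w : homog b g -> hspan w -> hspan (g v + w).

Lemma hspanD x y : hspan x -> hspan y -> hspan (x + y).
Proof.
move=> hx hy; elim: hx => [|b g v w hg _ IH]; rewrite ?add0r // -addrA.
exact: hspan_add hg IH.
Qed.

Lemma hspan_hom b (g : V -> W) v : homog b g -> hspan (g v).
Proof. by move=> hg; rewrite -[g v]addr0; apply: hspan_add hg hspan0. Qed.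

Lemma hspanP a x y : hspan x -> hspan y -> hspan (a *: x + y).
Proof.
move=> hx hy; elim: hx => [|b g v w hg _ IH]; first by rewrite scaler0 add0r.
rewrite scalerDr -addrA -(linear_Z _ _ (proj1 (proj1 hg))).
exact: hspan_add hg IH.
Qed.

Lemma hspan_scomp i x : hspan x -> hspan (scomp i x).
Proof.
elim=> [|b g v w hg _ IH]; first by rewrite linear0; exact: hspan0.
have [_ ge] := hg; rewrite linearD /=; apply: hspanD => //.
have -> : scomp i (g v) = g (scomp (b (+) i) v) by rewrite ge addbA addbb.
exact: hspan_hom hg.
Qed.

Lemma hspan_act beta x : hspan x -> hspan (act beta x).
Proof.
elim=> [|b g v w hg _ IH]; first by rewrite (linear_0 (act_linear _)); exact: hspan0.
have [[_ ga] _] := hg; rewrite (linear_D _ _ (act_linear _)) -ga.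
by apply: hspan_add hg IH.
Qed.

Implicit Types (gs : seq (V -> W)) (vs : nat -> V).

Local Notation get gs i := (nth (fun _ => 0) gs i).

(** Coordinates are indexed by [nat], so that prepending a map to [gs] is a shift. *)
Definition frame_sum gs vs : W := \sum_(i < size gs) get gs i (vs i).
(** Beyond the list, [get] returns the zero map, which is homogeneous of both parities. *)
Definition all_homog gs : Prop := forall i, exists b, homog b (get gs i).
Definition cover gs (w : W) : Prop := exists vs, w = frame_sum gs vs.
Definition direct gs : Prop :=
  forall vs, frame_sum gs vs = 0 -> forall i, (i < size gs)%N -> vs i = 0.

Lemma frame_sum_cons g gs vs :
  frame_sum (g :: gs) vs = g (vs 0) + frame_sum gs (fun i => vs i.+1).
Proof. by rewrite /frame_sum big_ord_recl. Qed.

Lemma frame_sum_linear gs a vs vs' : all_homog gs ->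
  frame_sum gs (fun i => a *: vs i + vs' i) = a *: frame_sum gs vs + frame_sum gs vs'.
Proof.
move=> gh; rewrite /frame_sum scaler_sumr -big_split; apply: eq_bigr => i _ /=.
by have [b [[gl _] _]] := gh i; rewrite gl.
Qed.

Lemma frame_sum_act gs beta vs : all_homog gs ->
  act beta (frame_sum gs vs) = frame_sum gs (fun i => act beta (vs i)).
Proof.
move=> gh; rewrite /frame_sum (linear_bigsum _ _ (act_linear _)).
by apply: eq_bigr => i _; have [b [[_ ga] _]] := gh i; rewrite ga.
Qed.

Lemma frame_sum0 gs : all_homog gs -> frame_sum gs (fun _ => 0) = 0.
Proof.
move=> gh; rewrite /frame_sum big1 // => i _.
by have [b [[gl _] _]] := gh i; rewrite (linear_0 gl).
Qed.

Lemma cover_linear gs a x y : all_homog gs -> cover gs x -> cover gs y -> cover gs (a *: x + y).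
Proof.
move=> gh [vs ->] [vs' ->]; exists (fun i => a *: vs i + vs' i).
by rewrite frame_sum_linear.
Qed.

Lemma cover0 gs : all_homog gs -> cover gs 0.
Proof. by move=> gh; exists (fun _ => 0); rewrite frame_sum0. Qed.

Lemma cover_scomp gs i x : all_homog gs -> cover gs x -> cover gs (scomp i x).
Proof.
move=> gh [vs ->]; have [b bP] := choice gh.
exists (fun j => scomp (b j (+) i) (vs j)); rewrite /frame_sum linear_sum.
by apply: eq_bigr => j _; have [_ ge] := bP j; rewrite ge addbA addbb.
Qed.

Lemma cover_act gs beta x : all_homog gs -> cover gs x -> cover gs (act beta x).
Proof.
by move=> gh [vs ->]; exists (fun j => act beta (vs j)); rewrite frame_sum_act.
Qed.

(** The vectors that [g] sends into the covered part form a subcomodule of [V]. If it is all of [V],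
    then [gs] already covers the image of [g]; if it is zero, prepending [g] keeps the sum
    direct. *)
Lemma extend_frame gs b (g : V -> W) : all_homog gs -> direct gs -> homog b g ->
  exists gs', [/\ all_homog gs', direct gs', forall w, cover gs w -> cover gs' w &
    forall v, cover gs' (g v)].
Proof.
move=> gh gd hg; have [[gl ga] ge] := hg.
have [[v v0 gv]|ng] := pselect (exists2 v, v != 0 & cover gs (g v)).
  exists gs; split=> //.
  have [|k0|//] := proj2 V_irr (fun v => cover gs (g v)); last first.
    by move: v0; rewrite (k0 _ gv) eqxx.
  apply: subcomodP => [|a x y cx cy|i x cx|beta x cx].
  - by rewrite (linear_0 gl); exact: cover0.
  - by rewrite gl; exact: cover_linear.
  - by rewrite ge; exact: cover_scomp.
  - by rewrite ga; exact: cover_act.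
exists (g :: gs); split=> [[|i]|vs|w [vs ->]|v].
- by exists b.
- exact: gh.
- rewrite frame_sum_cons => gs0.
  have v0 : vs 0%N = 0.
    apply: contrapT => /eqP v0; apply: ng; exists (vs 0%N) => //.
    exists (fun i => (-1) *: vs i.+1 + 0).
    rewrite frame_sum_linear // frame_sum0 // addr0 scaleN1r.
    by apply/eqP; rewrite -addr_eq0 gs0.
  move: gs0; rewrite v0 (linear_0 gl) add0r => /gd gs0 [|i] //=.
  by rewrite ltnS => /gs0.
- exists (fun i => if i is j.+1 then vs j else 0).
  by rewrite frame_sum_cons (linear_0 gl) add0r.
exists (fun i => if i is j.+1 then 0 else v).
by rewrite frame_sum_cons frame_sum0 // addr0.
Qed.

Lemma extend_frame_hspan gs w : all_homog gs -> direct gs -> hspan w ->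
  exists gs', [/\ all_homog gs', direct gs', forall x, cover gs x -> cover gs' x &
    cover gs' w].
Proof.
move=> gh gd hw; elim: hw => [|b g v x hg _ [gs1 [h1 d1 s1 c1]]].
  by exists gs; split=> //; exact: cover0.
have [gs2 [h2 d2 s2 c2]] := extend_frame h1 d1 hg.
exists gs2; split=> // [y /s1/s2 //|].
by rewrite -[g v]scale1r; apply: cover_linear => //; exact: s2.
Qed.

Lemma exists_frame (ws : seq W) : (forall w, w \in ws -> hspan w) ->
  exists gs, [/\ all_homog gs, direct gs & forall w, w \in ws -> cover gs w].
Proof.
elim: ws => [_|w ws IH hws].
  exists [::]; split=> [i|//|//]; exists false.
  by rewrite nth_nil; split; [exact: colin0|move=> j v; rewrite linear0].
have [|gs [gh gd gc]] := IH; first by move=> x xs; apply: hws; rewrite inE xs orbT.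
have [|gs' [gh' gd' sub cw]] := extend_frame_hspan gh gd (w := w).
  by apply: hws; rewrite mem_head.
by exists gs'; split=> // x; rewrite inE => /predU1P[->//|/gc/sub].
Qed.

(** Directness makes the coordinates of a vector unique, which forces the coordinate maps to be
    colinear. *)
Lemma frame_resolution gs : all_homog gs -> direct gs -> (forall w, cover gs w) ->
  exists n (g : 'I_n -> V -> W) (p : 'I_n -> W -> V),
    [/\ forall i, colin (g i), forall i, colin (p i) &
      forall w, w = \sum_(i < n) g i (p i w)].
Proof.
move=> gh gd /choice[p pP].
exists (size gs), (fun i => get gs i), (fun i w => p w i); split=> // i.
  by have [b []] := gh i.
have uniqv vs vs' : frame_sum gs vs = frame_sum gs vs' -> vs i = vs' i.
  move=> e; apply/eqP; rewrite -subr_eq0 addrC -scaleN1r; apply/eqP.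
  apply: (gd (fun i => (-1) *: vs' i + vs i)) => //.
  by rewrite frame_sum_linear // e scaleN1r addNr.
split=> [a x y|beta x].
  by apply: (uniqv _ (fun i => a *: p x i + p y i)); rewrite frame_sum_linear -?pP.
by apply: (uniqv _ (fun i => act beta (p x i))); rewrite -frame_sum_act -?pP.
Qed.

End Frames.

(** * Base change of representations *)

Section BaseChange.
Variables (F L : fieldType) (iota : {rmorphism F -> L}) (B : supercoalg F).
Variable U : supercomod B.

Local Notation W := (base_change iota U).
Local Notation ein := (ext_in iota).

Lemma base_change_coact u :
  coact (ein u : W) = tmaps iota (@ext_in F L iota U) (@ext_in F L iota B) (coact u).
Proof. exact: ext_coact_in. Qed.

Lemma base_change_scomp i u : scomp i (ein u : W) = ein (scomp i u).
Proof. exact: ext_comp_in. Qed.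

(** This brings stability under the dual algebra over L down to stability over F. *)
Lemma act_ext_scalar beta u :
  act (ext_scalar iota beta : {scalar ext_coalg iota B}) (ein u : W) = ein (act beta u).
Proof.
rewrite /act base_change_coact.
apply: (@tmaps_counitr F L iota U B (ext_space iota U) (ext_coalg iota B)) => //.
- exact: ext_in_semilinear.
- exact: ext_in_semilinear.
- exact: ext_scalar_in.
Qed.

Lemma ext_map_colin (f : U -> U) : colin f -> @colin L _ W W (ext_map (iota := iota) f).
Proof.
move=> fc; have fl := proj1 fc; have el := @ext_map_linear F L iota _ _ _ fl.
have il (Z : lmodType F) := @ext_in_semilinear F L iota Z.
apply: coact_colin => //; apply: ext_ext => [||u].
- by move=> a x y; rewrite el linearP.
- have tl := tmap_linear el (@linear_id _ (ext_coalg iota B)).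
  by move=> a x y; rewrite linearP tl.
rewrite ext_map_in // base_change_coact (colin_coact _ fc) base_change_coact.
have tl := tmap_linear el (@linear_id _ (ext_coalg iota B)).
have tl' := tmap_linear fl (@linear_id _ B).
have sl := tmaps_semilinear (il U) (il B).
move: (coact u); apply: (@tens_semi_ext F L iota) => [||x b].
- exact: comp_semilinear tl' sl.
- exact: semilinear_comp sl tl.
by rewrite tmap_pure // !tmaps_pure // tmap_pure // ext_map_in.
Qed.

Lemma gal_ext_coact (s : absgal iota) (w : W) :
  coact (gal_ext s w : W) = tmaps s (@gal_ext F L iota s U) (gal_coalg s B) (coact w).
Proof.
have gl := @gal_ext_semilinear F L iota s U.
have bl := cm_semilinear (gal_coalg s B).
have ggl := tmaps_semilinear gl bl.
move: w; apply: (@ext_semi_ext F L iota s) => [||u].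
- by apply: semilinear_comp gl _ => c x y; rewrite linearP.
- by apply: comp_semilinear ggl => c x y; rewrite linearP.
rewrite gal_ext_in base_change_coact; move: (coact u).
have il (Z : lmodType F) := @ext_in_semilinear F L iota Z.
have iil := tmaps_semilinear (il U) (il B).
apply: (@tens_semi_ext F L iota) => //.
- by move=> a x y; rewrite iil ggl gal_fix.
move=> x y; rewrite tmaps_pure // tmaps_pure //.
by rewrite gal_ext_in /= gal_coalg_in.
Qed.

Variable V : supercomod (ext_coalg iota B).

(** The s-semilinear map [gal_ext s] composed with [g] factors through the base change of [V] along
    [s]. The factor is colinear because [gal_ext s] is compatible with the coaction through
    [gal_coalg s], which also defines the coaction of the twist. *)
Lemma gal_twist_factor (s : absgal iota) b (g : V -> W) : homog b g ->
  exists2 h : gal_twist s V -> W, homog b h & forall v, h (ext_in s v) = gal_ext s (g v).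
Proof.
move=> [gc ge]; have gl := proj1 gc.
have sl := @gal_ext_semilinear F L iota s U.
have hl : Defs.semilinear s (fun v => gal_ext s (g v) : W) by exact: comp_semilinear gl sl.
have hL := ext_lift_linear hl; have hin v := ext_lift_in v hl.
exists (ext_lift (fun v => gal_ext s (g v))) => //; split.
  apply: coact_colin => //; apply: ext_ext => [||v].
  - by move=> a x y; rewrite hL linearP.
  - have tl := tmap_linear hL (@linear_id _ (ext_coalg iota B)).
    by move=> a x y; rewrite linearP tl.
  have cE : coact (ext_in s v : gal_twist s V) =
    tmaps s (@ext_in L L s V) (gal_coalg s B) (coact v) by exact: ext_coact_in.
  rewrite hin gal_ext_coact (colin_coact _ gc) cE.
  have tl := tmap_linear hL (@linear_id _ (ext_coalg iota B)).
  have tl' := tmap_linear gl (@linear_id _ (ext_coalg iota B)).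
  have bl := cm_semilinear (gal_coalg s B).
  have il := @ext_in_semilinear L L s V.
  move: (coact v); apply: (@tens_semi_ext L L s) => [||x y].
  - exact: comp_semilinear tl' (tmaps_semilinear sl bl).
  - exact: semilinear_comp (tmaps_semilinear il bl) tl.
  by rewrite tmap_pure // !tmaps_pure // tmap_pure // hin.
move=> i; apply: ext_ext => [||v].
- by move=> a x y; rewrite linearP hL.
- by move=> a x y; rewrite hL linearP.
have -> : scomp i (ext_in s v : gal_twist s V) = ext_in s (scomp i v).
  exact: ext_comp_in.
by rewrite !hin ge gal_ext_even.
Qed.


Hypothesis L_sep : is_separable_closure iota.
Hypothesis U_irr : irreducible U.

Section Resolution.
Hypothesis V_irr : irreducible V.
Hypothesis V_conj : forall s : absgal iota,
  siso (gal_twist s V) V \/ siso (gal_twist s V) (Pi V).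
Variables (b0 : bool) (f : V -> W).
Hypotheses (f_hom : homog b0 f) (f_inj : injective f).

Local Notation hspan := (@hspan L (ext_coalg iota B) V W).

(** The factor on the twist, preceded by the inverse of an isomorphism of the twist with [V] or
    [Pi V], is again a homogeneous map from [V] to [W]. *)
Lemma hspan_gal s w : hspan w -> hspan (gal_ext s w : W).
Proof.
have gl := @gal_ext_semilinear F L iota s U.
have gD x y : gal_ext s (x + y) = gal_ext s x + gal_ext s y :> W.
  by have := gl 1 x y; rewrite rmorph1 !scale1r.
elim=> [|b g v x hg _ IH].
  by rewrite -(ext_in0 iota U) gal_ext_in ext_in0; exact: hspan0.
rewrite gD; apply: hspanD => //.
have [h hh <-] := gal_twist_factor s hg.
have [b' [k kh [k' kK k'K]]] : exists b', exists2 k : gal_twist s V -> V,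
    homog b' k & bijective k.
  have [[k kb]|[k kb]] := V_conj s.
    by exists false, k => //; exact: shom_homog.
  by exists true, k => //; exact: shom_Pi_homog.
have k'h := homog_inv kK k'K kh.
rewrite -[ext_in s v]kK.
exact: (hspan_hom _ (homog_comp k'h hh)).
Qed.

Lemma hspan_total w : hspan w.
Proof.
have [v v0] := proj1 V_irr.
have f0 : f v != 0.
  apply: contra v0 => /eqP fv; apply/eqP/f_inj.
  by rewrite fv (linear_0 (proj1 (proj1 f_hom))).
have [u u0 hu] : exists2 u : U, u != 0 & hspan (ein u).
  apply: (@galois_descent F L iota L_sep U hspan).
  - by move=> a x y; exact: hspanP.
  - by move=> s x; exact: hspan_gal.
  - by exists (f v) => //; exact: hspan_hom f_hom.
have [|k0|kall] := proj2 U_irr (fun u => hspan (ein u)).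
- apply: subcomodP => [|a x y hx hy|i x hx|beta x hx].
  + by rewrite ext_in0; exact: hspan0.
  + by rewrite ext_in_semilinear; exact: hspanP.
  + by rewrite -base_change_scomp; exact: hspan_scomp.
  + by rewrite -act_ext_scalar; exact: hspan_act.
- by case/eqP: u0; exact: k0.
have [s ->] := ext_sum w; elim: s => [|p s IH]; first by rewrite big_nil; exact: hspan0.
by rewrite big_cons; apply: hspanP => //; exact: kall.
Qed.

Lemma base_change_resolution :
  exists n (g : 'I_n -> V -> W) (p : 'I_n -> W -> V),
    [/\ forall i, colin (g i), forall i, colin (p i) &
      forall w, w = \sum_(i < n) g i (p i w)].
Proof.
have [n [mu [e eP]]] := irreducible_fin_dim U_irr.
(* The finitely many [ein (e i)] span [W] over L, so a frame that covers them covers [W]. *)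
have [gs [gh gd gc]] := @exists_frame L _ V W V_irr (codom (fun i => ein (e i) : W))
  (fun w _ => hspan_total w).
apply: (frame_resolution gh gd) => w.
have [s ->] := ext_sum w; elim: s => [|p s IH]; first by rewrite big_nil; exact: cover0.
rewrite big_cons; apply: cover_linear => //.
rewrite (eP p.2) ext_in_sum; elim: (index_enum _) => [|i r IHr].
  by rewrite big_nil; exact: cover0.
rewrite big_cons ext_inZ; apply: cover_linear => //.
by apply: gc; exact: codom_f.
Qed.

End Resolution.

Section Descent.
Variables (n : nat) (mu : 'I_n -> {scalar U}) (e : 'I_n -> U).
Hypothesis eP : forall u, u = \sum_(i < n) mu i u *: e i.

(** The map [lambda (x) 1 : L (x) U -> U], for a linear form [lambda] on L *)
Definition ext_contr (lambda : {scalar restr iota L^o}) (w : W) : U :=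
  \sum_(i < n) lambda (ext_scalar iota (mu i) w : L) *: e i.

Variable lambda : {scalar restr iota L^o}.

Lemma ext_contrD x y : ext_contr lambda (x + y) = ext_contr lambda x + ext_contr lambda y.
Proof.
rewrite /ext_contr -big_split; apply: eq_bigr => i _.
rewrite scalar_D.
exact: etrans (congr1 (fun z => z *: e i) (scalar_D lambda _ _)) (scalerDl _ _ _).
Qed.

Lemma ext_contr_in a u : ext_contr lambda (a *: ein u) = lambda a *: u.
Proof.
rewrite [u in RHS]eP scaler_sumr; apply: eq_bigr => i _.
rewrite scalerA; congr (_ *: _).
have -> : ext_scalar iota (mu i) (a *: ein u) = iota (mu i u) * a.
  by rewrite scalar_Z ext_scalar_in mulrC.
rewrite [RHS]mulrC; exact: (scalar_Z lambda (mu i u) (a : restr iota L^o)).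
Qed.

Lemma ext_contrZ c w : ext_contr lambda (iota c *: w) = c *: ext_contr lambda w.
Proof.
move: w; apply: ext_additive_ext => [x y|x y|a u].
- by rewrite scalerDr ext_contrD.
- by rewrite ext_contrD scalerDr.
rewrite scalerA !ext_contr_in scalerA; congr (_ *: _).
exact: (scalar_Z lambda c (a : restr iota L^o)).
Qed.

Lemma ext_contr_act beta w :
  ext_contr lambda (act (ext_scalar iota beta : {scalar ext_coalg iota B}) w) =
  act beta (ext_contr lambda w).
Proof.
have al := @act_linear L _ W (ext_scalar iota beta : {scalar ext_coalg iota B}).
have bl := @act_linear F _ U beta.
move: w; apply: ext_additive_ext => [x y|x y|a u].
- by rewrite (linear_D _ _ al) ext_contrD.
- by rewrite ext_contrD (linear_D _ _ bl).
by rewrite (linear_Z _ _ al) act_ext_scalar !ext_contr_in (linear_Z _ _ bl).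
Qed.

Lemma ext_contr0 : ext_contr lambda 0 = 0.
Proof. by apply: (addrI (ext_contr lambda 0)); rewrite -ext_contrD !addr0. Qed.

Lemma ext_coord (w : W) : w = \sum_(i < n) ext_scalar iota (mu i) w *: ein (e i).
Proof.
move: w; apply: ext_additive_ext => [x y//|x y|a u].
  by rewrite -big_split; apply: eq_bigr => i _; rewrite scalar_D scalerDl.
rewrite {1}(eP u) ext_in_sum scaler_sumr; apply: eq_bigr => i _.
by rewrite scalar_Z ext_scalar_in ext_inZ scalerA.
Qed.

Lemma ext_contr_map (d : U -> U) w : linear d ->
  ext_contr lambda (ext_map (iota := iota) d w) = d (ext_contr lambda w).
Proof.
move=> dl; have el := @ext_map_linear F L iota _ _ _ dl.
move: w; apply: ext_additive_ext => [x y|x y|a u].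
- by rewrite (linear_D _ _ el) ext_contrD.
- by rewrite ext_contrD (linear_D _ _ dl).
by rewrite (linear_Z _ _ el) ext_map_in // !ext_contr_in (linear_Z _ _ dl).
Qed.

Lemma ext_contr_colin (phi : W -> W) :
  colin phi -> colin (fun u => ext_contr lambda (phi (ein u))).
Proof.
move=> [pl pa]; split=> [a x y|beta u].
  by rewrite ext_in_semilinear pl ext_contrD ext_contrZ.
by rewrite -act_ext_scalar pa ext_contr_act.
Qed.

End Descent.

(** [End(L (x) U) = L (x) End(U)] *)
Lemma endo_descent (phi : W -> W) : colin phi ->
  exists m (t : 'I_m -> L) (d : 'I_m -> U -> U),
   [/\ forall i, colin (d i),
       forall u, phi (ein u) = \sum_(i < m) t i *: ein (d i u) &
       forall (d' : U -> U), linear d' ->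
          (forall w, phi (ext_map (iota := iota) d' w) = ext_map (iota := iota) d' (phi w)) ->
          forall i u, d i (d' u) = d' (d i u)].
Proof.
move=> pc; have [n [mu [e eP]]] := irreducible_fin_dim U_irr.
(* The coefficients of [phi] on the spanning family [e] are finitely many elements of L, so finitely
   many forms [l q] and vectors over F reconstruct all of them. *)
pose a (ij : 'I_n * 'I_n) : restr iota L^o := ext_scalar iota (mu ij.2) (phi (ein (e ij.1))).
have [T hT] := finite_rank_identity (codom a).
pose l i := (tnth (in_tuple T) i).1.
exists (size T), (fun i => (tnth (in_tuple T) i).2 : L).
exists (fun i u => ext_contr mu e (l i) (phi (ein u))); split.
- by move=> i; exact: ext_contr_colin.
(* Recovery of [w] from its contractions by the forms [l i] is an F-linear condition, so it is
   enough to check it on the [phi (ein (e i))]. *)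
- pose good (w : W) := w = \sum_(i < size T)
    ((tnth (in_tuple T) i).2 : L) *: ein (ext_contr mu e (l i) w).
  have good_add c x y : good x -> good y -> good (iota c *: x + y).
    move=> gx gy; rewrite /good {1}gx {1}gy scaler_sumr -big_split.
    apply: eq_bigr => i _ /=; rewrite ext_contrD ext_contrZ // ext_in_semilinear.
    by rewrite scalerDr !scalerA mulrC.
  have good0 : good 0.
    rewrite /good big1 // => i _.
    by rewrite ext_contr0 ext_in0 scaler0.
  have good_e i : good (phi (ein (e i))).
    rewrite /good {1}(ext_coord eP (phi (ein (e i)))).
    transitivity (\sum_(j < n) \sum_(q < size T)
        (iota (l q (a (i, j))) * ((tnth (in_tuple T) q).2 : L)) *: ein (e j)).
      apply: eq_bigr => j _; rewrite -scaler_suml; congr (_ *: _).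
      rewrite -[LHS]/(a (i, j) : L) {1}(hT (a (i, j))) ?codom_f //.
      by rewrite big_tnth.
    rewrite exchange_big; apply: eq_bigr => q _; rewrite ext_in_sum scaler_sumr.
    by apply: eq_bigr => j _; rewrite ext_inZ scalerA mulrC.
  move=> u; rewrite -/(good _) {1}(eP u) ext_in_sum.
  elim: (index_enum _) => [|i r IH].
    by rewrite big_nil (linear_0 (proj1 pc)).
  by rewrite big_cons ext_inZ (proj1 pc); exact: good_add.
move=> d' dl comm i u; rewrite -ext_contr_map //.
by rewrite -comm ext_map_in.
Qed.
End BaseChange.

(** * The endomorphism superalgebra *)

(** A family with independent images has at most [n] members. One of maximal length spans, since a
    vector whose image lies outside the span of the images could be added to it. *)
Lemma fin_dim_of_injective (K : fieldType) (M : lmodType K) n (f : M -> 'rV[K]_n) :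
  linear f -> injective f ->
  exists m (e : 'I_m -> M), forall x, exists c : 'I_m -> K, x = \sum_(i < m) c i *: e i.
Proof.
move=> fl finj.
pose free m := `[< exists e : 'I_m -> M, row_free (\matrix_(i < m) f (e i)) >].
have free0 : exists m, free m.
  exists 0%N; apply/asboolP; exists (fun i => 0).
  by rewrite -row_leq_rank.
have free_le m : free m -> (m <= n)%N.
  by move=> /asboolP[e]; rewrite -row_leq_rank => /leq_trans; apply; exact: rank_leq_col.
case: (ex_maxnP free0 free_le) => m /asboolP[e e_free] mmax.
exists m, e => x; set A := \matrix_(i < m) f (e i) in e_free.
have [/submxP[c xc]|nx] := boolP (f x <= A)%MS.
  exists (fun i => c 0 i); apply: finj; rewrite (linear_bigsum _ _ fl) xc mulmx_sum_row.
  by apply: eq_bigr => i _; rewrite (linear_Z _ _ fl) rowK.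
have: free m.+1; last by move/mmax; rewrite ltnn.
apply/asboolP; exists (fun i => if unlift ord0 i is Some j then e j else x).
have -> : \matrix_(i < m.+1) f (if unlift ord0 i is Some j then e j else x)
    = col_mx (f x) A :> 'M_(1 + m, n).
  apply/row_matrixP => i; rewrite rowK.
  case: (unliftP ord0 i) => [j ->|->].
    have -> : lift ord0 j = rshift 1 j :> 'I_(1 + m) by apply/val_inj.
    by rewrite rowKd rowK.
  have -> : ord0 = lshift m ord0 :> 'I_(1 + m) by apply/val_inj.
  by rewrite rowKu; apply/rowP => j; rewrite mxE.
rewrite -row_leq_rank; have -> : \rank (col_mx (f x) A) = \rank (f x + A)%MS.
  by rewrite addsmxE.
have fx0 : f x != 0 by apply: contraNneq nx => ->; exact: sub0mx.
have dx : (f x :&: A = 0)%MS.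
  apply/eqP; apply: contraR nx => cap0; apply: submx_trans (capmxSr (f x) A).
  rewrite -(geq_leqif (mxrank_leqif_sup (capmxSl (f x) A))).
  by rewrite (leq_trans (rank_leq_row _)) // lt0n mxrank_eq0.
rewrite (mxrank_disjoint_sum dx) rank_rV fx0 add1n ltnS.
by rewrite row_leq_rank.
Qed.

Section SuperEndTheory.
Variables (K : fieldType) (B : supercoalg K) (U : supercomod B).
Variable U_irr : irreducible U.

Local Notation E := (super_end (proj1 U_irr)).
Implicit Types z w : E.

(** Forgetting the grading: [ev] identifies the superalgebra, as an ordinary algebra, with all
    colinear maps from [U] to [U]. *)
Definition ev z (u : U) : U := z.1 u + z.2 u.

Lemma ev_colin z : colin (ev z).
Proof.
apply: colin_add; first exact: (proj1 (shom_homog z.1)).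
exact: (proj1 (shom_Pi_homog z.2)).
Qed.

(** The even component is read off from the diagonal blocks of [ev], the odd one from the
    off-diagonal blocks. *)
Lemma ev_inj z w : (forall u, ev z u = ev w u) -> z = w.
Proof.
have h1 x := shom_homog (x : E).1; have h2 x := shom_Pi_homog (x : E).2.
have e1 x u : (x : E).1 u = scomp false (ev x (scomp false u)) + scomp true (ev x (scomp true u)).
  rewrite /ev !linearD /= -!(proj2 (h1 x)) !scomp_scomp /=.
  have s2 i v : scomp i (x.2 v : U) = x.2 (scomp (~~ i) v).
    by rewrite (proj2 (h2 x)) addTb negbK.
  rewrite !s2 !scomp_scomp /= (linear_0 (proj1 (proj1 (h2 x)))) !addr0.
  by rewrite -(linear_D _ _ (proj1 (proj1 (h1 x)))) scomp_sum.
have e2 x u : (x : E).2 u = scomp true (ev x (scomp false u)) + scomp false (ev x (scomp true u)) :> U.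
  have s2 i v : scomp i (x.2 v : U) = x.2 (scomp (~~ i) v).
    by rewrite (proj2 (h2 x)) addTb negbK.
  rewrite /ev !linearD /= -!(proj2 (h1 x)) !s2 !scomp_scomp /=.
  rewrite (linear_0 (proj1 (proj1 (h1 x)))) !add0r.
  by rewrite -(linear_D _ _ (proj1 (proj1 (h2 x)))) scomp_sum.
move=> zw; apply: super_end_eq => u; first by rewrite !e1 !zw.
by rewrite [LHS]e2 [RHS]e2 !zw.
Qed.

Lemma ev_mul z w u : ev (z * w) u = ev z (ev w u).
Proof.
have l1 := proj1 (proj1 (shom_homog z.1)); have l2 := proj1 (proj1 (shom_Pi_homog z.2)).
rewrite /ev super_endM1 [(z * w).2 u]super_endM2 (linear_D _ _ l1) (linear_D _ _ l2).
by rewrite addrACA [z.2 _ + z.2 _]addrC addrACA.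
Qed.

Lemma ev_1 u : ev 1 u = u.
Proof. by rewrite /ev /= addr0. Qed.

Lemma ev_comb a z w u : ev (a *: z + w) u = a *: ev z u + ev w u.
Proof.
rewrite /ev.
have -> : (a *: z + w).1 u = a *: z.1 u + w.1 u.
  by rewrite -shom_scaleE -shom_addE.
have -> : ((a *: z + w).2 u : U) = a *: (z.2 u : U) + w.2 u.
  exact: etrans (shom_addE (a *: z.2) w.2 u) (congr1 (fun x => x + w.2 u) (shom_scaleE a z.2 u)).
by rewrite scalerDr addrACA.
Qed.

Lemma ev_0 u : ev 0 u = 0.
Proof. by have := ev_comb (-1) 0 0 u; rewrite scaler0 addr0 scaleN1r addNr. Qed.

Lemma ev_surj (f : U -> U) : colin f -> exists z, forall u, ev z u = f u.
Proof.
move=> /colin_decomp[f0 [f1 [/homog_shom[g0 g0E] /homog_shom_Pi[g1 g1E] fE]]].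
by exists (g0, g1) => u; rewrite /ev /= fE g0E g1E.
Qed.

Lemma ev_scalar c u : ev (c%:A : E) u = c *: u.
Proof. by rewrite -[c%:A]addr0 ev_comb ev_1 ev_0 addr0.
Qed.

Definition scalar_center : Prop :=
  forall f : U -> U, colin f ->
    (forall d : U -> U, colin d -> forall u, f (d u) = d (f u)) ->
    exists c, forall u, f u = c *: u.

Lemma scalar_centerP :
  scalar_center <-> forall z, (forall x, z * x = x * z) -> exists c : K, z = c%:A.
Proof.
split=> [cU z zc|cE f fc fcen].
  have [|d dc u|c zE] := cU (ev z); first exact: ev_colin.
    by have [x xE] := ev_surj dc; rewrite -!xE -!ev_mul zc.
  by exists c; apply: ev_inj => u; rewrite ev_scalar.
have [z zE] := ev_surj fc.
have [x|c zc] := cE z.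
  by apply: ev_inj => u; rewrite !ev_mul !zE fcen //; exact: ev_colin.
by exists c => u; rewrite -zE zc ev_scalar.
Qed.

Lemma super_end_fin_dim : exists n (e : 'I_n -> E), forall x,
  exists c : 'I_n -> K, x = \sum_(i < n) c i *: e i.
Proof.
have [n [mu [e eP]]] := irreducible_fin_dim U_irr.
apply: (@fin_dim_of_injective K E _ (fun z => mxvec (\matrix_(i < n, j < n) mu j (ev z (e i))))).
  move=> a z w; rewrite -linearP; congr mxvec; apply/matrixP => i j.
  by rewrite !mxE ev_comb scalar_D scalar_Z.
move=> z w /(can_inj mxvecK)/matrixP zw; apply: ev_inj => u.
have [zl _] := ev_colin z; have [wl _] := ev_colin w.
rewrite (eP u) (linear_bigsum _ _ zl) (linear_bigsum _ _ wl); apply: eq_bigr => i _.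
rewrite (linear_Z _ _ zl) (linear_Z _ _ wl); congr (_ *: _).
rewrite (eP (ev z _)) (eP (ev w _)); apply: eq_bigr => j _; congr (_ *: _).
by have := zw i j; rewrite !mxE.
Qed.

Lemma odd_scalar (f : U -> U) c : homog true f -> (forall u, f u = c *: u) -> c = 0.
Proof.
move=> [_ fe] fc; have [v /homogeneous_neq0[i v0]] := proj1 U_irr.
have := fe i (scomp i v); rewrite scomp_scomp eqxx !fc linearZ /= scomp_scomp.
case: (i) v0 => v0 /= /eqP; rewrite scaler0 scaler_eq0 (negbTE v0) orbF; exact: eqP.
Qed.

Lemma homogeneous_inv b z : z != 0 -> homog b (ev z) ->
  exists2 y, homog b (ev y) & y * z = 1.
Proof.
move=> z0 zh.
have nz : ~ forall u, ev z u = 0.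
  by move=> e; case/eqP: z0; apply: ev_inj => u; rewrite e ev_0.
have [//|zi] := schur_inj U_irr zh; have [//|/choice[g gK]] := schur_surj U_irr zh.
have Kg : cancel (ev z) g by move=> u; apply: zi; rewrite gK.
have gh := homog_inv Kg gK zh; have [y yE] := ev_surj (proj1 gh).
exists y; first by rewrite (funext yE).
by apply: ev_inj => u; rewrite ev_mul ev_1 yE Kg.
Qed.

Lemma homog_comb b a (f g : U -> U) : homog b f -> homog b g ->
  homog b (fun u => a *: f u + g u).
Proof.
move=> [fc fe] [gc ge]; split; first exact/colin_add/gc/colin_scale/fc.
by move=> i v; rewrite fe ge linearP.
Qed.

(** An ideal containing [1 + w] with [w] odd also contains the homogeneous
    commutators [d * w - w * d]; if they all vanish, [w] is a central scalar. *)
Lemma super_end_simple : scalar_center -> forall I : E -> Prop,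
  two_sided_ideal I -> (forall x, I x -> x = 0) \/ (forall x, I x).
Proof.
move=> /scalar_centerP cen I [I0 ID IM].
have [[x Ix x0]|nI] := pselect (exists2 x, I x & x != 0); last first.
  left=> x Ix; apply/eqP; apply: contrapT => /negP x0; by apply: nI; exists x.
right=> a.
have I1 : I 1 -> I a by move=> /(IM a)[+ _]; rewrite mulr1.
have Ih b z : I z -> z != 0 -> homog b (ev z) -> I a.
  move=> Iz z0 /(homogeneous_inv z0)[y _ yz]; apply: I1.
  by rewrite -yz; case: (IM y z Iz).
pose x0' : E := (x.1, 0); pose x1 : E := (0, x.2).
have xE : x = x0' + x1.
  apply: ev_inj => u; rewrite -[x0']scale1r ev_comb scale1r.
  by rewrite /ev /= addr0 add0r.
have x0h : homog false (ev x0').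
  have -> : ev x0' = x.1 by apply: funext => u; rewrite /ev /= addr0.
  exact: shom_homog.
have x1h : homog true (ev x1).
  have -> : ev x1 = x.2 by apply: funext => u; rewrite /ev /= add0r.
  exact: shom_Pi_homog.
(* Without even component [x] is odd and, being nonzero, a unit. *)
have [x00|x00] := eqVneq x0' 0.
  by apply: Ih x1h; move: Ix x0; rewrite xE x00 add0r.
have [y yh yx] := homogeneous_inv x00 x0h.
pose w := y * x1.
have wh : homog true (ev w).
  have -> : ev w = (fun u => ev y (ev x1 u)) by apply: funext => u; rewrite ev_mul.
  exact: homog_comp x1h yh.
(* Left multiplication by the inverse of the even component normalises [x] to [1 + w]. *)
have I1w : I (1 + w) by rewrite /w -yx -mulrDr -xE; case: (IM y x Ix).
have IB p q : I p -> I q -> I (p - q).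
  by move=> Ip Iq; apply: ID => //; rewrite -mulN1r; case: (IM (-1) q Iq).
have Icomm d : I (d * w - w * d).
  have -> : d * w - w * d = d * (1 + w) - (1 + w) * d.
    by rewrite mulrDr mulrDl mulr1 mul1r opprD addrACA subrr add0r.
  by apply: IB; case: (IM d _ I1w).
apply: contrapT => nIa.
(* A nonzero homogeneous element is a unit, so a nonzero commutator would put [a] in [I]. *)
have commh b d : homog b (ev d) -> d * w = w * d.
  move=> dh; apply/eqP; rewrite -subr_eq0; apply: contrapT => /negP c0.
  apply: nIa; apply: (Ih (b (+) true)) (Icomm d) c0 _.
  have -> : ev (d * w - w * d) =
      (fun u => (-1) *: ev w (ev d u) + ev d (ev w u)).
    apply: funext => u; rewrite -!ev_mul -ev_comb scaleN1r addrC //.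
  apply: homog_comb; first exact: homog_comp dh wh.
  by rewrite addbC; exact: homog_comp wh dh.
have [d|c wc] := cen w.
  pose d0 : E := (d.1, 0); pose d1 : E := (0, d.2).
  have dE : d = d0 + d1.
    apply: ev_inj => u; rewrite -[d0]scale1r ev_comb scale1r.
    by rewrite /ev /= addr0 add0r.
  rewrite dE mulrDl mulrDr; congr (_ + _); apply: esym.
    apply: (commh false); have -> : ev d0 = d.1 by apply: funext => u; rewrite /ev /= addr0.
    exact: shom_homog.
  apply: (commh true); have -> : ev d1 = d.2 by apply: funext => u; rewrite /ev /= add0r.
  exact: shom_Pi_homog.
(* The scalar [w] is odd, hence 0, so [1 + w] is 1. *)
apply: nIa; apply: I1; have := I1w; rewrite wc (odd_scalar (c := c) wh) ?scale0r ?addr0 //.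
by move=> u; rewrite wc ev_scalar.
Qed.

Lemma central_simple_super_end :
  central_simple (super_end_superalg (proj1 U_irr)) <-> scalar_center.
Proof.
split=> [[_ cen _]|cen]; first exact/scalar_centerP.
split; [exact: super_end_fin_dim|exact/scalar_centerP|exact: super_end_simple].
Qed.

End SuperEndTheory.

(** * Comparison of the centers *)

Section Comparison.
Variables (F L : fieldType) (iota : {rmorphism F -> L}) (B : supercoalg F).
Hypothesis L_sep : is_separable_closure iota.
Variables (V : supercomod (ext_coalg iota B)) (U : supercomod B).
Hypotheses (V_sqr : super_quasi_rational V) (U_irr : irreducible U).
Local Notation W := (base_change iota U).
Local Notation ein := (ext_in iota).
Variables (f : V -> W).
Hypotheses (f_hom : homog false f) (f_inj : injective f).

Let V_irr : irreducible V.
Proof. by case: V_sqr. Qed.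

Lemma homog_false_scalar (h : V -> V) : homog false h -> exists c, forall v, h v = c *: v.
Proof.
move=> /homog_shom[g gE]; have [_ /(_ g)[c gc] _] := V_sqr.
by exists c => v; rewrite -gE.
Qed.

Lemma homog_true_zero (h : V -> V) : ~ siso V (Pi V) -> homog true h -> forall v, h v = 0.
Proof.
move=> nV hh; have [//|hi] := schur_inj V_irr hh; have [//|hs] := schur_surj V_irr hh.
have [g gE] := homog_shom_Pi hh; case: nV; exists g.
have [k kP] := choice hs.
by exists k => v; [apply: hi|]; rewrite /= gE ?kP.
Qed.

Lemma colin_scalar (h : V -> V) :
  ~ siso V (Pi V) -> colin h -> exists c, forall v, h v = c *: v.
Proof.
move=> nV /colin_decomp[h0 [h1 [/homog_false_scalar[c h0c] /(homog_true_zero nV) h10 hE]]].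
by exists c => v; rewrite hE h0c h10 addr0.
Qed.

Let resolution : exists n (g : 'I_n -> V -> W) (p : 'I_n -> W -> V),
    [/\ forall i, colin (g i), forall i, colin (p i) &
      forall w, w = \sum_(i < n) g i (p i w)].
Proof. by have [_ _ V_conj] := V_sqr; exact: base_change_resolution f_hom f_inj. Qed.

(** By [endo_descent], [psi] is a combination over L of extended endomorphisms of [U], and [phi]
    commutes with each of these. *)
Lemma ext_map_central (phi : U -> U) : colin phi ->
  (forall d : U -> U, colin d -> forall u, phi (d u) = d (phi u)) ->
  forall psi : W -> W, colin psi -> forall w,
    ext_map (iota := iota) phi (psi w) = psi (ext_map (iota := iota) phi w).
Proof.
move=> pc pcen psi psic; have [m [t [d [dc psiE _]]]] := endo_descent U_irr psic.
have el := @ext_map_linear F L iota _ _ _ (proj1 pc).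
apply: ext_ext => [||u].
- exact: linear_comp (proj1 psic) el.
- exact: linear_comp el (proj1 psic).
rewrite (ext_map_in iota (proj1 pc)) !psiE.
rewrite (linear_bigsum _ _ el); apply: eq_bigr => i _.
by rewrite (linear_Z _ _ el) (ext_map_in iota (proj1 pc)) pcen.
Qed.

Lemma scalar_center_of_not_siso : ~ siso V (Pi V) -> scalar_center U.
Proof.
move=> nV phi pc pcen; have [n [g [p [gc pcol idE]]]] := resolution.
pose Phi : W -> W := ext_map (iota := iota) phi.
have PhiC : colin Phi by exact: ext_map_colin.
have PhiZ (psi : W -> W) w : colin psi -> Phi (psi w) = psi (Phi w).
  by move=> psic; exact: ext_map_central.
have fc := proj1 f_hom.
(* The composites of the [p i] with [f] are scalars, not all zero since [f] is injective; dividing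
   by a nonzero one gives a retraction of [f]. *)
have [q qc qf] : exists2 q : W -> V, colin q & forall v, q (f v) = v.
  have /choice[c cE] i : exists c, forall v, p i (f v) = c *: v.
    by apply: colin_scalar nV _; exact: colin_comp fc (pcol i).
  have [i ci] : exists i, c i != 0.
    apply: contrapT => nc; have [v /eqP v0] := proj1 V_irr; apply: v0.
    apply: f_inj; rewrite (linear_0 (proj1 fc)) (idE (f v)) big1 // => i _.
    have -> : p i (f v) = 0.
      rewrite cE; have [->|ci] := eqVneq (c i) 0; first by rewrite scale0r.
      by case: nc; exists i.
    exact: linear_0 (proj1 (gc i)).
  exists (fun w => (c i)^-1 *: p i w); first exact: colin_scale.
  by move=> v; rewrite cE scalerA mulVf // scale1r.
have [a qa] : exists a, forall v, q (Phi (f v)) = a *: v.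
  by apply: colin_scalar nV _; apply: colin_comp qc; exact: colin_comp fc PhiC.
have Phif v : Phi (f v) = a *: f v.
  have := PhiZ _ (f v) (colin_comp qc fc).
  by rewrite /= qf qa (linear_Z _ _ (proj1 fc)).
(* [Phi] commutes with [h] composed with [q], which carries the copy [f] of [V] to the copy [h]; so
   the same scalar [a] occurs on every copy. *)
have Phig (h : V -> W) v : colin h -> Phi (h v) = a *: h v.
  move=> hc; have := PhiZ _ (f v) (colin_comp qc hc).
  by rewrite /= Phif qf (linear_Z _ _ (proj1 qc)) qf (linear_Z _ _ (proj1 hc)).
have PhiE w : Phi w = a *: w.
  rewrite {1 2}(idE w) (linear_bigsum _ _ (proj1 PhiC)) scaler_sumr.
  by apply: eq_bigr => i _; exact: Phig.
(* A form on L with value 1 at 1 brings [a] down to F: it contracts [ein (phi u)] to [phi u] and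
   [a *: ein u] to [l a *: u]. *)
have [l l1] := @nonvanishing_functional F (restr iota L^o) (1 : L) (oner_neq0 L).
have [m [mu [e eP]]] := irreducible_fin_dim U_irr.
exists (l a) => u.
rewrite -(ext_contr_in eP l a u) -PhiE /Phi (ext_map_in iota (proj1 pc)).
by rewrite -[ein _]scale1r ext_contr_in // l1 scale1r.
Qed.

Lemma siso_not_scalar_center : siso V (Pi V) -> ~ scalar_center U.
Proof.
move=> [eps' eps'_bij] cen; pose eps : V -> V := eps'.
have epsh : homog true eps by exact: shom_Pi_homog.
have [delta epsK deltaK] : bijective eps by [].
have deltah : homog true delta by exact: homog_inv epsK deltaK epsh.
have epsc := proj1 epsh.
(* The even part of [h] is a scalar and its odd part a scalar multiple of [eps]; both commute with
   [eps]. *)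
have comm (h : V -> V) v : colin h -> h (eps v) = eps (h v).
  move=> /colin_decomp[h0 [h1 [/homog_false_scalar[c h0c] h1h hE]]].
  have [c' h1c] := homog_false_scalar (homog_comp deltah h1h).
  have {}h1c x : h1 x = c' *: eps x by rewrite -h1c epsK.
  rewrite !hE !h0c !h1c (linear_D _ _ (proj1 epsc)).
  by rewrite !(linear_Z _ _ (proj1 epsc)).
have [n [g [p [gc pc idE]]]] := resolution.
pose Eps (w : W) := \sum_(i < n) g i (eps (p i w)).
have Epsc : colin Eps.
  by apply: colin_sum => i; apply: colin_comp (gc i); exact: colin_comp (pc i) epsc.
(* [Eps] induces [eps] on every image of [V], not only on those of the chosen resolution; centrality
   follows. *)
have Epsg (h : V -> W) v : colin h -> Eps (h v) = h (eps v).
  move=> hc; rewrite (idE (h (eps v))); apply: eq_bigr => i _; congr (g i _).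
  by rewrite -(comm (fun v => p i (h v))) //; exact: colin_comp hc (pc i).
have Epsz (psi : W -> W) w : colin psi -> Eps (psi w) = psi (Eps w).
  move=> psic; rewrite {1}(idE w) !(linear_bigsum _ _ (proj1 psic)).
  rewrite (linear_bigsum _ _ (proj1 Epsc)); apply: eq_bigr => i _.
  by rewrite (Epsg (fun v => psi (g i v))) //; exact: colin_comp (gc i) psic.
(* The components [d i] inherit centrality from [Eps]. If they were all scalars, [Eps], and with it
   the odd bijection [eps], would be a scalar. *)
have [m [t [d [dc EpsE dcomm]]]] := endo_descent U_irr Epsc.
have /choice[c cE] i : exists c, forall u, d i u = c *: u.
  apply: cen => // d' d'c u; apply: dcomm; first exact: (proj1 d'c).
  by move=> w; apply: Epsz; exact: ext_map_colin.
pose a := \sum_(i < m) t i * iota (c i).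
have Epsa w : Eps w = a *: w.
  move: w; apply: ext_ext => [||u]; first exact: (proj1 Epsc).
    by move=> b x y; rewrite scalerDr !scalerA mulrC.
  rewrite EpsE scaler_suml; apply: eq_bigr => i _.
  by rewrite cE ext_inZ scalerA.
have epsa v : eps v = a *: v.
  apply: f_inj; rewrite -(Epsg f) ?Epsa ?(linear_Z _ _ (proj1 (proj1 f_hom))) //.
  exact: (proj1 f_hom).
have a0 := odd_scalar V_irr epsh epsa.
have [v /eqP v0] := proj1 V_irr; apply: v0; apply: (can_inj epsK).
by rewrite !epsa a0 !scale0r.
Qed.

(** An isomorphism of a conjugate with [Pi V], followed by the inverse of the odd automorphism [e],
    is an even isomorphism onto [V]. *)
Lemma quasi_rational_of_siso : siso V (Pi V) -> quasi_rational V.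
Proof.
move=> [e e_bij]; have [irr sc conj] := V_sqr; split=> // s.
have [//|[h h_bij]] := conj s.
have eh : @homog L _ true V V e by exact: shom_Pi_homog.
have [k eK kK] := e_bij.
have kh : @homog L _ true V V k by exact: (@homog_inv L _ true V V e).
have hh : @homog L _ true (gal_twist s V) V h by exact: shom_Pi_homog.
have [g gE] := homog_shom (homog_comp hh kh); exists g.
have -> : (g : gal_twist s V -> V) = k \o h by apply: funext => v; rewrite gE.
by apply: bij_comp h_bij; exists e.
Qed.

End Comparison.

(* [V_F] is any irreducible representation of [G] whose base change contains
   [V]. *)
Theorem proposition4p1 (F L : fieldType) (iota : {rmorphism F -> L})
    (F_char : 2%N \notin [pchar F]) (L_sep : is_separable_closure iota)
    (G : hopf_superalg F)
    (V : supercomod (ext_coalg iota G)) (V_sqr : super_quasi_rational V)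
    (V_F : supercomod G) (V_F_irr : irreducible V_F)
    (V_sub : is_subrep V (base_change iota V_F)) :
  epsilon V_F_irr = Minus <-> quasi_rational V /\ siso V (Pi V).
Proof.
have [f f_inj] := V_sub; have f_hom := shom_homog f.
rewrite /epsilon /superalg_sign; case: asboolP => [/central_simple_super_end cen|ncs].
  (* Here the sign is [Plus], and it remains to refute the right-hand side. *)
  split=> // -[_ V_Pi].
  by case: (siso_not_scalar_center L_sep V_sqr V_F_irr f_hom f_inj V_Pi).
split=> // _; have V_Pi : siso V (Pi V).
  apply: contrapT => nV; apply/ncs/central_simple_super_end.
  exact: (scalar_center_of_not_siso L_sep V_sqr V_F_irr f_hom f_inj nV).
by split=> //; exact: quasi_rational_of_siso.
Qed.
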